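(* Let $G$ be a locally finite graph and let $r\ge 3$ be an integer. The following are equivalent: (i) $G$ is $r$-locally chordal. (ii) $G$ is an $r$-acyclic region intersection graph. (iii) $G$ admits an $r$-acyclic graph-decomposition into cliques. (iv) $G$ admits a graph-decomposition into cliques which $r$-locally induces tree-decompositions. (v) $G$ admits a graph-decomposition into cliques which induces $r$-local separations.
   Context: All graphs are simple (no loops, no parallel edges) and possibly infinite; a graph is locally finite if every vertex has finite degree. For a vertex $v$ of $G$, $d_G$ denotes graph distance, and $N^{d}[v]$ is the set of vertices at distance at most $d$ from $v$. The ball $B_{r/2}(v)$ is the subgraph of $G$ whose vertices are all vertices at distance at most $r/2$ from $v$ and whose edges are all edges of $G$ for which the sum of the distances of its two endpoints to $v$ is strictly less than $r$. A graph is chordal if each of its cycles of length at least $4$ has a chord. $G$ is $r$-locally chordal if $B_{r/2}(v)$ is chordal for every vertex $v$. A clique is a vertex-subset inducing a complete subgraph (the empty set is allowed). A region of a graph $H$ is a nonempty connected subgraph of $H$. A region representation of $G$ over a graph $H$ is a map $v\mapsto H_v$ assigning to each vertex $v$ of $G$ a region $H_v$ of $H$ such that, for distinct $u,v$, $uv\in E(G)$ if and only if $H_u\cap H_v\neq\emptyset$. For $X\subseteq V(G)$ write $H_X=\bigcup_{x\in X}H_x$. The region representation is $r$-acyclic if $H_X$ is acyclic for every $X\subseteq V(G)$ with $|X|\le r$. $G$ is an $r$-acyclic region intersection graph if it has an $r$-acyclic region representation over some graph $H$. A graph-decomposition of $G$ is a pair $(H,\mathcal V)$ of a graph $H$ and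 a family $\mathcal V=(V_h)_{h\in V(H)}$ of vertex-subsets of $G$ (bags) such that $G=\bigcup_{h\in V(H)}G[V_h]$ and, for every vertex $v$ of $G$, the subgraph $H[W_v]$ induced on $W_v=\{h\in V(H): v\in V_h\}$ is connected. It comes with a fixed choice of co-parts $H_v$, where $H_v$ is any connected spanning subgraph of $H[W_v]$; again $H_X=\bigcup_{x\in X}H_x$. It is into cliques if every bag $V_h$ is a clique of $G$. It is $r$-acyclic if $H_X$ is acyclic for every $X\subseteq V(G)$ with $|X|\le r$. A tree-decomposition is a graph-decomposition whose $H$ is a tree. Locally inducing tree-decompositions: for a vertex $v$ of $G$ put $H^{v,r}=\bigcup\{H_u : d_G(u,v)<r/2\}$, $V^{v,r}_h=V_h\cap N^{r/2}[v]$ for each node $h$ of $H^{v,r}$, and $\mathcal V^{v,r}=(V^{v,r}_h)_h$. To $u\in N^{r/2}[v]$ assign the co-part $H^{v,r}_u=H_u$ if $d_G(u,v)<r/2$ and $H^{v,r}_u=H_u\cap H^{v,r}$ if $d_G(u,v)=r/2$. $(H,\mathcal V)$ $r$-locally induces tree-decompositions if, for every vertex $v$, $(H^{v,r},\mathcal V^{v,r})$ with these co-parts is a tree-decomposition of $B_{r/2}(v)$, i.e. $H^{v,r}$ is a tree, $B_{r/2}(v)$ is the union of its subgraphs induced on the sets $V_h^{v,r}$, and each $H^{v,r}_u$ is a connected spanning subgraph of the subgraph of $H^{v,r}$ induced on $\{h:u\in V^{v,r}_h\}$. Inducing local separations: here the co-parts are the induced subgraphs $H_v=H[W_v]$. For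 $X\subseteq V(G)$ let $\partial_GX$ be the set of edges of $G$ with exactly one end in $X$. A pre-separation of $G$ is a set $\{E_0,X,E_1\}$ with $X\subseteq V(G)$ and $E_0,E_1$ disjoint with union $\partial_GX$. An $X$-walk is a walk that starts and ends in $X$ but internally avoids $X$; it is $r$-local if it is contained in a cycle of $G$ of length at most $r$ or consists of a single edge with both ends in $X$. A pre-separation $\{E_0,X,E_1\}$ is an $r$-local separation if no $r$-local $X$-walk traverses both an edge of $E_0$ and an edge of $E_1$. Suppose $(H,\mathcal V)$ satisfies (a) $H_v$ is a tree for every vertex $v$ of $G$, and (b) $H_u\cap H_v$ is connected for every edge $uv$ of $G$. For an edge $f=h_0h_1$ of $H$ let $V_f=V_{h_0}\cap V_{h_1}$; for $v\in V_f$ and $i=0,1$ let $H^v_i$ be the component of $H_v-f$ containing $h_i$, let $E_i^v=\{vw\in\partial_GV_f : w\in V_h\text{ for some } h\in V(H_i^v)\}$ and $E_i=\bigcup_{v\in V_f}E_i^v$. Then $\{E_0,V_f,E_1\}$ is a pre-separation, called the one induced by $f$. $(H,\mathcal V)$ induces $r$-local separations if it satisfies (a) and (b) and, for every edge $f$ of $H$, the pre-separation induced by $f$ is an $r$-local separation of $G$. *)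

(* Defs.v *)
(* MathComp with the classical sets of MathComp-Analysis. *)
From mathcomp Require Import ssreflect ssrfun ssrbool eqtype ssrnat seq fintype.
From mathcomp Require Import boolp classical_sets functions cardinality.

Set Implicit Arguments.
Unset Strict Implicit.
Unset Printing Implicit Defensive.

Local Open Scope classical_set_scope.
#[local] Obligation Tactic := idtac.

(* A simple, possibly infinite graph whose vertices are elements of the ambient
   type T.  Subgraphs, balls, unions and intersections of graphs over T are
   again graphs over T. *)
Record graph (T : Type) := Graph {
  vset : set T;
  adj : T -> T -> Prop;
  adj_sym : forall x y, adj x y -> adj y x;
  adj_irr : forall x, ~ adj x x;
  adj_vset : forall x y, adj x y -> vset x }.

Section Graphs.
Variable T : Type.
Implicit Types (G H K : graph T) (X : set T).

Definition subgraph K G : Prop :=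
  vset K `<=` vset G /\ forall x y, adj K x y -> adj G x y.

Definition same_graph K G : Prop := subgraph K G /\ subgraph G K.

Definition spanning_subgraph K G : Prop := subgraph K G /\ vset K = vset G.

Definition locally_finite G : Prop :=
  forall v, vset G v -> finite_set [set w | adj G v w].

Definition clique G X : Prop :=
  X `<=` vset G /\ forall x y, X x -> X y -> x <> y -> adj G x y.

(* The walk w 0, ..., w n of length n; the values of w beyond n are irrelevant. *)
Definition walk G (n : nat) (w : nat -> T) : Prop :=
  (forall i, i <= n -> vset G (w i)) /\
  (forall i, i < n -> adj G (w i) (w i.+1)).

(* d_G(u, v) = n; no n qualifies when u and v lie in different components. *)
Definition at_distance G (u v : T) (n : nat) : Prop :=
  (exists w, walk G n w /\ w 0 = u /\ w n = v) /\
  (forall m w, walk G m w -> w 0 = u -> w m = v -> n <= m).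

Definition reachable G (x y : T) : Prop :=
  exists n w, walk G n w /\ w 0 = x /\ w n = y.

Definition connected G : Prop :=
  forall x y, vset G x -> vset G y -> reachable G x y.

(* ordS is the cyclic successor, so c lists the vertices of the cycle in order. *)
Definition is_cycle G (n : nat) (c : 'I_n -> T) : Prop :=
  3 <= n /\ injective c /\ forall i, adj G (c i) (c (ordS i)).

Definition acyclic G : Prop := forall n (c : 'I_n -> T), ~ is_cycle G c.

Definition is_tree G : Prop := vset G !=set0 /\ connected G /\ acyclic G.

Definition has_chord G (n : nat) (c : 'I_n -> T) : Prop :=
  exists i j, adj G (c i) (c j) /\ j != ordS i /\ i != ordS j.

Definition chordal G : Prop :=
  forall n (c : 'I_n -> T), 4 <= n -> is_cycle G c -> has_chord G c.

Program Definition induced G X : graph T :=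
  @Graph T (vset G `&` X) (fun x y => adj G x y /\ X x /\ X y) _ _ _.
Next Obligation. by move=> G X x y [xy [Xx Xy]]; split; first exact: adj_sym. Qed.
Next Obligation. by move=> G X x [xx _]; apply: adj_irr xx. Qed.
Next Obligation. by move=> G X x y [xy [Xx _]]; split=> //; apply: adj_vset xy. Qed.

Program Definition gcap G H : graph T :=
  @Graph T (vset G `&` vset H) (fun x y => adj G x y /\ adj H x y) _ _ _.
Next Obligation. by move=> G H x y [xyG xyH]; split; apply: adj_sym. Qed.
Next Obligation. by move=> G H x [xx _]; apply: adj_irr xx. Qed.
Next Obligation. by move=> G H x y [xyG xyH]; split; [apply: adj_vset xyG | apply: adj_vset xyH]. Qed.

Program Definition gbigcup (I : Type) (J : set I) (F : I -> graph T) : graph T :=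
  @Graph T (\bigcup_(i in J) vset (F i))
           (fun x y => exists2 i, J i & adj (F i) x y) _ _ _.
Next Obligation. by move=> I J F x y [i Ji xy]; exists i => //; apply: adj_sym. Qed.
Next Obligation. by move=> I J F x [i _ xx]; apply: adj_irr xx. Qed.
Next Obligation. by move=> I J F x y [i Ji xy]; exists i => //; apply: adj_vset xy. Qed.

Program Definition del_edge G (a b : T) : graph T :=
  @Graph T (vset G) (fun x y => adj G x y /\ [set x; y] <> [set a; b]) _ _ _.
Next Obligation. by move=> G a b x y [xy ne]; split; [exact: adj_sym | rewrite setUC]. Qed.
Next Obligation. by move=> G a b x [xx _]; apply: adj_irr xx. Qed.
Next Obligation. by move=> G a b x y [xy _]; apply: adj_vset xy. Qed.

Definition component G (x : T) : graph T := induced G [set y | reachable G x y].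

(* The conditions d_G(u, v) <= r/2 and d_G(u, v) < r/2. *)
Definition closed_nbhd G (r : nat) (v : T) : set T :=
  [set u | exists2 d, at_distance G u v d & 2 * d <= r].

Definition open_nbhd G (r : nat) (v : T) : set T :=
  [set u | exists2 d, at_distance G u v d & 2 * d < r].

Lemma ball_edge_end G (r : nat) (v x y : T) (a b : nat) :
  adj G x y -> at_distance G x v a -> at_distance G y v b -> a + b < r ->
  closed_nbhd G r v x.
Proof.
move=> xy ax [[w [[wV wE] [w0 wb]]] _] abr; exists a => //.
suff ab : a <= b.+1.
  by rewrite mul2n -addnn; apply: leq_trans abr; rewrite -addnS leq_add2l.
apply: (ax.2 b.+1 (fun i => if i is j.+1 then w j else x)) => //.
split=> -[|i] //=.
- by move=> _; apply: adj_vset xy.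
- exact: wV.
- by rewrite w0.
- exact: wE.
Qed.

(* The radius is r/2, and the two ends of an edge have distance sum < r. *)
Program Definition ball G (r : nat) (v : T) : graph T :=
  @Graph T (closed_nbhd G r v)
    (fun x y => adj G x y /\ exists a b,
       at_distance G x v a /\ at_distance G y v b /\ a + b < r) _ _ _.
Next Obligation.
move=> G r v x y [xy [a [b [xa [yb abr]]]]]; split; first exact: adj_sym.
by exists b, a; rewrite addnC.
Qed.
Next Obligation. by move=> G r v x [xx _]; apply: adj_irr xx. Qed.
Next Obligation.
by move=> G r v x y [xy [a [b [xa [yb abr]]]]]; apply: ball_edge_end xy xa yb abr.
Qed.

Definition locally_chordal G (r : nat) : Prop :=
  forall v, vset G v -> chordal (ball G r v).

(* Edges are unordered pairs [set x; y], so sets of edges have type set (set T). *)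
Definition edge_boundary G X : set (set T) :=
  [set e | exists x y, adj G x y /\ X x /\ ~ X y /\ e = [set x; y]].

Definition pre_separation G (E0 : set (set T)) X (E1 : set (set T)) : Prop :=
  X `<=` vset G /\ E0 `&` E1 = set0 /\ E0 `|` E1 = edge_boundary G X.

Definition outer_walk G X (n : nat) (w : nat -> T) : Prop :=
  walk G n w /\ X (w 0) /\ X (w n) /\ forall i, 0 < i < n -> ~ X (w i).

Definition walk_in_cycle (n : nat) (w : nat -> T) (m : nat) (c : 'I_m -> T) : Prop :=
  (forall i, i <= n -> exists j, w i = c j) /\
  (forall i, i < n -> exists j, [set w i; w i.+1] = [set c j; c (ordS j)]).

Definition local_outer_walk G (r : nat) X (n : nat) (w : nat -> T) : Prop :=
  outer_walk G X n w /\
  ((exists m (c : 'I_m -> T), is_cycle G c /\ m <= r /\ walk_in_cycle n w c)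
   \/ (n = 1 /\ X (w 0) /\ X (w 1))).

Definition traverses (n : nat) (w : nat -> T) (E : set (set T)) : Prop :=
  exists2 i, i < n & E [set w i; w i.+1].

Definition local_separation G (r : nat) (E0 : set (set T)) X (E1 : set (set T)) :
    Prop :=
  pre_separation G E0 X E1 /\
  forall n w, local_outer_walk G r X n w -> ~ (traverses n w E0 /\ traverses n w E1).

End Graphs.

Section Decompositions.
Variables T U : Type.
Implicit Types (G : graph T) (H : graph U) (part : T -> graph U) (bag : U -> set T).

Definition region H (K : graph U) : Prop :=
  subgraph K H /\ vset K !=set0 /\ connected K.

(* Only the values of part on the vertices of G matter. *)
Definition region_representation G H part : Prop :=
  (forall v, vset G v -> region H (part v)) /\
  (forall u v, vset G u -> vset G v -> u <> v ->
     (adj G u v <-> vset (gcap (part u) (part v)) !=set0)).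

Definition r_acyclic G part (r : nat) : Prop :=
  forall X : set T, X `<=` vset G -> (X #<= `I_r)%card -> acyclic (gbigcup X part).

Definition nodes_of H bag (v : T) : set U := [set h | vset H h /\ bag h v].

Definition full_part H bag (v : T) : graph U := induced H (nodes_of H bag v).

(* (H, bag) is a graph-decomposition of G with chosen co-parts part; only the
   bags of nodes of H and the co-parts of vertices of G matter. *)
Definition graph_decomposition G H bag part : Prop :=
  (forall h, vset H h -> bag h `<=` vset G) /\
  same_graph G (gbigcup (vset H) (fun h => induced G (bag h))) /\
  (forall v, vset G v -> connected (full_part H bag v)) /\
  (forall v, vset G v ->
     connected (part v) /\ spanning_subgraph (part v) (full_part H bag v)).

Definition tree_decomposition G H bag part : Prop :=
  graph_decomposition G H bag part /\ is_tree H.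

Definition into_cliques G H bag : Prop := forall h, vset H h -> clique G (bag h).

Definition local_host G part (r : nat) (v : T) : graph U :=
  gbigcup (open_nbhd G r v) part.

Definition local_bag G bag (r : nat) (v : T) (h : U) : set T :=
  bag h `&` closed_nbhd G r v.

Definition local_part G part (r : nat) (v u : T) : graph U :=
  if `[< open_nbhd G r v u >] then part u
  else gcap (part u) (local_host G part r v).

Definition locally_induces_tree_decompositions G bag part (r : nat) : Prop :=
  forall v, vset G v ->
    tree_decomposition (ball G r v) (local_host G part r v)
      (local_bag G bag r v) (local_part G part r v).

(* The edges vw of the boundary of X, the set of vertices common to the bags of
   h0 and h1, with v in X and w in some bag of a node in the component
   containing h0 of the co-part of v minus the edge h0h1. *)
Definition side_edges G H bag (h0 h1 : U) : set (set T) :=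
  let X := bag h0 `&` bag h1 in
  [set e | exists v w, X v /\ e = [set v; w] /\ edge_boundary G X e /\
     exists2 h, vset (component (del_edge (full_part H bag v) h0 h1) h0) h
              & bag h w].

(* The co-parts are the induced ones here. *)
Definition induces_local_separations G H bag (r : nat) : Prop :=
  (forall v, vset G v -> is_tree (full_part H bag v)) /\
  (forall u v, adj G u v ->
     connected (gcap (full_part H bag u) (full_part H bag v))) /\
  (forall h0 h1, adj H h0 h1 ->
     local_separation G r (side_edges G H bag h0 h1) (bag h0 `&` bag h1)
                          (side_edges G H bag h1 h0)).

End Decompositions.

Definition acyclic_region_intersection_graph (T : Type) (G : graph T) (r : nat) :
    Prop :=
  exists (U : Type) (H : graph U) (part : T -> graph U),
    region_representation G H part /\ r_acyclic G part r.

(* Main.v *)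
Require Import Defs.
From mathcomp Require Import ssreflect ssrfun ssrbool eqtype ssrnat seq fintype.
From mathcomp Require Import div path boolp classical_sets functions cardinality zify.


(** All five conditions are equivalent to a sixth, purely finite one: [G] has no
    induced cycle of length between 4 and [r], and no neighbourhood of a vertex
    contains an induced cycle of length at least 4 ([hole_wheel_free]).

    Everything is phrased with functions to booleans, as in cohomology mod 2.  A
    graph is connected when its locally constant functions are constant
    ([connectedP]), and acyclic when every symmetric function [c] on its edges
    has a potential, that is a function [f] with [f x (+) f y = c x y] on edges
    ([acyclicP]).  In this form acyclic graphs can be glued: a family of acyclic
    graphs with connected pairwise intersections and nonempty triple
    intersections has an acyclic union as soon as its intersection graph is
    chordal ([acyclic_nerve]), because chordality makes the differences of the
    chosen potentials into a coboundary ([chordal_potential]).  Conversely the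
    intersection of two connected subgraphs of an acyclic graph is connected
    ([connected_gcap]), so that families of subtrees have chordal intersection
    graphs ([subtrees_cycle_chord]).

    The heart is the passage from the finite condition to a decomposition.  The
    host is the graph on all nonempty cliques of [G] in which a clique [S] is
    joined to [S + w] for one chosen [w] in each component of the link of [S],
    the subgraph induced on the common neighbours of [S].  These choices are
    independent of each other, and still the cliques containing a fixed nonempty
    clique always induce a tree ([star_connected], [star_acyclic]): going down
    from the larger cliques, which exist only in bounded size since [G] is locally
    finite, the part above [X] is a union of trees indexed by the chordal link of
    [X], and [X] is attached by exactly one edge to each component.  The
    nerve lemma then also shows that the union of at most [r] co-parts is
    acyclic, since at most [r] vertices induce a chordal graph.

    An [r]-acyclic decomposition yields trees on the balls of radius [r/2] by
    gluing the potentials found along short walks to the centre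
    ([local_host_acyclic]), and yields local separations because an edge of the
    host is a bridge of the union of the co-parts of the vertices of a short
    cycle ([edge_local_separation]).  In the other direction, trees on the balls
    make the balls chordal ([ball_chordal]), chordal balls contain the short
    cycles and the neighbourhoods ([hole_wheel_free_of_balls]), and if an edge
    of the host induces a local separation, then a short cycle cannot cross it
    ([short_cycle_common_node], [hole_wheel_free_of_separations]). *)
Set Implicit Arguments.
Unset Strict Implicit.
Unset Printing Implicit Defensive.

Local Open Scope classical_set_scope.

(** * Cyclic indices *)
Section CyclicIndices.
Variable n : nat.

Lemma ordS_inord_mod i : ordS (inord (i %% n.+1) : 'I_n.+1) = inord (i.+1 %% n.+1).
Proof.
apply: val_inj; rewrite /= !inordK ?ltn_mod //.
by rewrite -addn1 modnDml addn1.
Qed.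

Lemma ord_inord_mod (i : 'I_n.+1) : inord (i %% n.+1) = i.
Proof. by rewrite modn_small // inord_val. Qed.

Lemma ordS_inord k : k < n -> ordS (inord k : 'I_n.+1) = inord k.+1.
Proof.
by move=> lt; have := ordS_inord_mod k; rewrite !modn_small //; apply: leq_trans lt _.
Qed.

Lemma ordS_inord_max : ordS (inord n : 'I_n.+1) = inord 0.
Proof. by have := ordS_inord_mod n; rewrite modnn modn_small. Qed.

Lemma inord_neq k l : k <= n -> l <= n -> k <> l -> inord k <> inord l :> 'I_n.+1.
Proof. by move=> kn ln kl /(congr1 val); rewrite /= !inordK //; lia. Qed.

End CyclicIndices.

Lemma iter_ordS_neq n m (k : 'I_n) : 0 < m < n -> iter m (@ordS n) k <> k.
Proof.
move=> /andP[m0 mn] /(congr1 val).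
have -> : val (iter m (@ordS n) k) = (k + m) %% n.
  elim: m {m0 mn} => [|m IH]; first by rewrite addn0 modn_small.
  by rewrite iterS /= IH addnS -addn1 modnDml addn1.
move=> /= E; have : k + m == k + 0 %[mod n] by rewrite E addn0 modn_small.
by rewrite eqn_modDl mod0n modn_small // eqn0Ngt m0.
Qed.

(** * Connectedness through locally constant functions *)
Section Reachability.
Variable T : Type.
Implicit Types (G K : graph T) (x y z : T).

Lemma adj_vsetr G x y : adj G x y -> vset G y.
Proof. by move=> xy; apply: adj_vset (adj_sym xy). Qed.

Lemma subgraph_refl G : subgraph G G.
Proof. by split. Qed.

Lemma reachable_refl G x : vset G x -> reachable G x x.
Proof. by move=> Gx; exists 0, (fun=> x); split. Qed.

Lemma reachable_step G x y z : reachable G x y -> adj G y z -> reachable G x z.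
Proof.
move=> [n [w [[wV wE] [w0 wn]]]] yz.
exists n.+1, (fun i => if i <= n then w i else z); split; last first.
  by rewrite w0 ltnn.
split=> i.
  by case: (leqP i n) => [ni _|_ _]; [apply: wV | apply: adj_vsetr yz].
rewrite ltnS => ni; rewrite ni; case: ltnP => [|ge]; first exact: wE.
have -> : i = n by lia.
by rewrite wn.
Qed.

Lemma reachable_ind G x (P : T -> Prop) : P x ->
  (forall y z, P y -> adj G y z -> P z) -> forall y, reachable G x y -> P y.
Proof.
move=> Px Pstep y [n [w [[_ wE] [w0 <-]]]].
suff H i : i <= n -> P (w i) by apply: H.
elim: i => [|i IH] lt; first by rewrite w0.
by apply: Pstep (wE _ lt); apply: IH; apply: ltnW.
Qed.

Lemma reachable_vset G x y : reachable G x y -> vset G x /\ vset G y.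
Proof. by move=> [n [w [[wV _] [<- <-]]]]; split; apply: wV. Qed.

Lemma reachable_trans G x y z :
  reachable G x y -> reachable G y z -> reachable G x z.
Proof. by move=> xy; apply: reachable_ind => // a b; apply: reachable_step. Qed.

Lemma reachable_sym G x y : reachable G x y -> reachable G y x.
Proof.
move=> xy; have [Gx _] := reachable_vset xy.
apply: (reachable_ind (P := fun a => reachable G a x)) xy => [|a b ax ab].
  exact: reachable_refl.
apply: reachable_trans ax; apply: reachable_step (adj_sym ab).
exact: reachable_refl (adj_vsetr ab).
Qed.

Lemma reachable_sub G K x y : subgraph K G -> reachable K x y -> reachable G x y.
Proof.
move=> [KV KE] xy; have [Kx _] := reachable_vset xy.
apply: (reachable_ind (P := reachable G x)) xy => [|a b xa ab].
  by apply: reachable_refl; apply: KV.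
by apply: reachable_step xa _; apply: KE.
Qed.

Definition locally_constant G (f : T -> bool) : Prop :=
  forall x y, adj G x y -> f x = f y.

Lemma locally_constant_sub G K f :
  subgraph K G -> locally_constant G f -> locally_constant K f.
Proof. by move=> [_ KE] Gf x y /KE/Gf. Qed.

Lemma locally_constant_reachable G f x y :
  locally_constant G f -> reachable G x y -> f x = f y.
Proof.
move=> Gf; apply: (reachable_ind (P := fun a => f x = f a)) => // a b -> ab.
exact: Gf.
Qed.

Lemma connectedP G : connected G <->
  forall f, locally_constant G f -> forall x y, vset G x -> vset G y -> f x = f y.
Proof.
split=> [Gc f Gf x y Gx Gy|Gc x y Gx Gy].
  by apply: locally_constant_reachable Gf _; apply: Gc.
pose f a := `[< reachable G x a >].
suff Gf : locally_constant G f.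
  by apply/asboolP; rewrite -/(f y) -(Gc f Gf x y) //; apply/asboolP/reachable_refl.
move=> a b ab; apply: asbool_equiv_eq; split=> H; first exact: reachable_step H ab.
exact: reachable_step H (adj_sym ab).
Qed.

End Reachability.

(** * Shortest odd closed walks *)
Section ClosedWalks.
Variables (T : eqType) (e : rel T) (c : T -> T -> bool).
Hypotheses (e_sym : symmetric e) (e_irr : irreflexive e).
Hypothesis c_sym : forall x y, c x y = c y x.

Fixpoint walk_sum (x : T) (p : seq T) : bool :=
  if p is y :: q then c x y (+) walk_sum y q else false.

Lemma walk_sum_cat x p q :
  walk_sum x (p ++ q) = walk_sum x p (+) walk_sum (last x p) q.
Proof. by elim: p x => //= y p IH x; rewrite IH addbA. Qed.

(** The walk consists of [x] followed by [p]; since it ends in [x], the entries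
    of [p] alone list the vertices of the cyclic walk. *)
Definition odd_closed_walk (x : T) (p : seq T) : Prop :=
  [/\ path e x p, last x p = x & walk_sum x p].

Lemma shortest_odd_closed_walk x p : odd_closed_walk x p ->
  exists y q, odd_closed_walk y q /\
    forall y' q', odd_closed_walk y' q' -> size q <= size q'.
Proof.
elim: {p}(size p) {-2}p x (leqnn (size p)) => [|n IH] p x.
  by case: p => // _ [].
move=> pn xp.
case: (pselect (exists y q, odd_closed_walk y q /\ size q < size p)).
  by move=> [y [q [yq qp]]]; apply: IH yq; lia.
move=> H; exists x, p; split=> // y q yq; rewrite leqNgt; apply/negP => qp.
by apply: H; exists y, q.
Qed.

Section Shortest.
Variables (x : T) (p : seq T).
Hypothesis xp : odd_closed_walk x p.
Hypothesis p_min : forall y q, odd_closed_walk y q -> size p <= size q.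

Let even_of_short y q :
  path e y q -> last y q = y -> size q < size p -> walk_sum y q = false.
Proof.
move=> yq yl qp; apply/negP => ys.
by have := leq_trans qp (p_min (And3 yq yl ys)); rewrite ltnn.
Qed.

(** A repeated vertex would cut the walk into two shorter closed walks, and the
    sum of one of them would be odd. *)
Lemma shortest_uniq : uniq p.
Proof.
apply: contraT => /(uniqPn x) [i [j [ij jp pij]]].
have [pe pl ps] := xp; move: pij.
set y := nth x p j => pij.
have defp : p = take i p ++ y :: take (j - i.+1) (drop i.+1 p) ++ y :: drop j.+1 p.
  rewrite -{1}(cat_take_drop i p) (drop_nth x) ?(ltn_trans ij) // pij.
  rewrite -{1}(cat_take_drop (j - i.+1) (drop i.+1 p)) drop_drop.
  have -> : j - i.+1 + i.+1 = j by lia.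
  by rewrite (drop_nth x jp).
move: defp; set p1 := take i p; set p2 := take _ _; set p3 := drop j.+1 p.
clearbody y p1 p2 p3 => defp.
have sp : size p = (size p1 + size p2 + size p3).+2.
  by rewrite defp !size_cat /= !size_cat /=; lia.
move: pe pl ps; rewrite {1 2 3}defp !walk_sum_cat !cat_path !last_cat /=.
rewrite walk_sum_cat cat_path last_cat /=.
move=> /andP[e1 /and3P[ey e2 /andP[e2y e3]]] pl.
have H1 : walk_sum y (p2 ++ [:: y]) = false.
  by apply: even_of_short; rewrite ?cat_path ?last_cat ?size_cat /= ?e2 ?e2y //; lia.
have H2 : walk_sum x (p1 ++ y :: p3) = false.
  by apply: even_of_short; rewrite ?cat_path ?last_cat ?size_cat /= ?e1 ?ey //; lia.
move: H1 H2; rewrite !walk_sum_cat /= addbF.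
by case: (walk_sum x p1) (c _ y) (walk_sum y p2) (c _ y) (walk_sum y p3) => [] [] [] [] [].
Qed.

Lemma shortest_size : 2 < size p.
Proof.
have [pe pl ps] := xp; case: p pe pl ps => [|y [|z [|? ?]]] //=.
  by rewrite andbT => exy yx; move: exy; rewrite yx e_irr.
by move=> _ ->; rewrite c_sym addbF addbb.
Qed.

(** A chord cuts the walk into two shorter closed walks that both use the chord,
    so that their sums add up to the sum of the whole walk. *)
Lemma shortest_chordless i j : i < j < size p -> e (nth x p i) (nth x p j) ->
  j = i.+1 \/ (i = 0 /\ j.+1 = size p).
Proof.
move=> /andP[ij jp] eij; apply: contrapT => /not_orP[ji1 not_ends].
have [pe pl ps] := xp; move: eij; set y := nth x p i; set z := nth x p j => eyz.
have defp : p = take i p ++ y :: take (j - i.+1) (drop i.+1 p) ++ z :: drop j.+1 p.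
  rewrite -{1}(cat_take_drop i p) (drop_nth x) ?(ltn_trans ij) //.
  rewrite -{1}(cat_take_drop (j - i.+1) (drop i.+1 p)) drop_drop.
  have -> : j - i.+1 + i.+1 = j by lia.
  by rewrite (drop_nth x jp).
have s1 : size (take i p) = i by apply: size_takel; lia.
have s3 : size (drop j.+1 p) = size p - j.+1 by rewrite size_drop.
have s2 : size (take (j - i.+1) (drop i.+1 p)) = j - i.+1.
  by apply: size_takel; rewrite size_drop; lia.
move: defp s1 s2 s3.
set p1 := take i p; set p2 := take _ _; set p3 := drop j.+1 p => defp s1 s2 s3.
move: pe pl ps; rewrite {1 2 3}defp !walk_sum_cat !cat_path !last_cat /=.
rewrite walk_sum_cat cat_path last_cat /=.
move=> /andP[e1 /and3P[ey e2 /andP[e2y e3]]] pl.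
have H1 : walk_sum y (p2 ++ [:: z; y]) = false.
  apply: even_of_short; rewrite ?cat_path ?last_cat ?size_cat /= ?e2 ?e2y //.
    by rewrite e_sym eyz.
  by rewrite s2; lia.
have H2 : walk_sum x (p1 ++ [:: y, z & p3]) = false.
  apply: even_of_short; rewrite ?cat_path ?last_cat ?size_cat /= ?e1 ?ey ?eyz //.
  by rewrite s1 s3; lia.
move: H1 H2; rewrite !walk_sum_cat /= addbF (c_sym z y).
by case: (walk_sum x p1) (c _ y) (walk_sum y p2) (c _ z) (c y z) (walk_sum z p3)
  => [] [] [] [] [] [].
Qed.

End Shortest.
End ClosedWalks.

(** * Potentials: acyclic and chordal graphs *)
Section Potentials.
Variable T : Type.
Implicit Types (G K : graph T) (c : T -> T -> bool).

(** In the language of cohomology mod 2, [c] is a cochain on the edges, and [f]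
    is a function whose coboundary is [c]. *)
Definition potential G c (f : T -> bool) : Prop :=
  forall x y, adj G x y -> f x (+) f y = c x y.

Definition has_potentials G : Prop :=
  forall c, (forall x y, c x y = c y x) -> exists f, potential G c f.

Definition triangle (x y z : T) (i : 'I_3) : T := nth x [:: x; y; z] i.

Lemma triangle_cycle G x y z :
  adj G x y -> adj G y z -> adj G z x -> is_cycle G (triangle x y z).
Proof.
move=> xy yz zx; split=> //; split.
  have irr a b : adj G a b -> a <> b by move=> ab E; apply: (@adj_irr _ G a); rewrite {2}E.
  move: (irr _ _ xy) (irr _ _ yz) (irr _ _ zx) => nxy nyz nzx.
  move=> [[|[|[|i]]] hi] [[|[|[|j]]] hj] //= E; rewrite /triangle /= in E;
    by [exact: val_inj | case: nxy | case: nyz | case: nzx].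
by move=> [[|[|[|i]]] hi].
Qed.

Definition adjb G : rel {classic T} := fun x y => `[< adj G x y >].

(** The value at [x] is the sum along any walk from [x] to a root chosen in the
    component of [x]; it does not depend on the walk when all closed walks have
    even sum. *)
Lemma closed_walks_potential G c : (forall x y, c x y = c y x) ->
  (forall (x : {classic T}) p, ~ odd_closed_walk (adjb G) c x p) ->
  exists f, potential G c f.
Proof.
move=> c_sym even.
pose e := adjb G.
pose W (x y : {classic T}) b := exists p,
  [/\ path e x p, last x p = y & @walk_sum {classic T} c x p = b].
have W_trans x y z a b : W x y a -> W y z b -> W x z (a (+) b).
  move=> [p [xp <- <-]] [q [yq <- <-]]; exists (p ++ q).
  by rewrite cat_path last_cat walk_sum_cat xp yq.
have W_edge x y : adj G x y -> W x y (c x y).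
  by move=> xy; exists [:: y]; rewrite /= addbF andbT; split=> //; apply/asboolP.
have W_sym x y a : W x y a -> W y x a.
  move=> [p [xp <- <-]]; elim: p x xp => [|z p IH] x /=; first by exists [::].
  move=> /andP[/asboolP xz /IH zp]; rewrite addbC c_sym.
  by apply: W_trans zp _; apply: W_edge (adj_sym xz).
have W_fun x y a b : W x y a -> W x y b -> a = b.
  move=> /W_sym ya /(W_trans _ _ _ _ _ ya) [p [xp pl ps]].
  have := even y p; case: (a) (b) ps => [] [] //= ps H; case: H; split=> //.
have [[x0 _]|noT] := pselect (exists x : {classic T}, True); last first.
  by exists xpredT => x; case: noT; exists x.
pose reach (x : {classic T}) : set {classic T} := [set y | exists a, W y x a].
pose root (x : {classic T}) := xget x0 (reach x).
exists (fun x => `[< W (root x) x true >]) => x y xy.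
have rootE : root y = root x.
  congr (xget _ _); apply/seteqP; split=> z [a za]; eexists.
    by apply: W_trans za _; apply: W_edge (adj_sym xy).
  by apply: W_trans za _; apply: W_edge xy.
have [a xa] : reach x (root x).
  by apply: (@xgetPex _ x0 (reach x)); exists x; exists false; exists [::].
have ya := W_trans _ _ _ _ _ xa (W_edge _ _ xy).
have val z b : W (root x) z b -> `[< W (root x) z true >] = b.
  case: b => zb; first by apply/asboolP.
  by apply/asboolP => /(W_fun _ _ _ _ zb).
by rewrite rootE (val _ _ xa) (val _ _ ya) addKb.
Qed.

(** The clique complex of a chordal graph has trivial first cohomology: a
    shortest closed walk with odd sum is a cycle without chords, hence a
    triangle, but the sums around triangles vanish. *)
Lemma chordal_potential G c : (forall x y, c x y = c y x) -> chordal G ->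
  (forall x y z, adj G x y -> adj G y z -> adj G z x ->
     c x y (+) c y z (+) c z x = false) ->
  exists f, potential G c f.
Proof.
move=> c_sym G_chordal c_tri; apply: closed_walks_potential => // x1 p1.
move=> /shortest_odd_closed_walk[x [p [xp p_min]]].
pose e := adjb G.
have e_sym : symmetric e.
  by move=> a b; apply: asbool_equiv_eq; split; apply: adj_sym.
have e_irr : irreflexive e by move=> a; apply/asboolP; apply: adj_irr.
have up : uniq p := shortest_uniq xp p_min.
have sp : 2 < size p := shortest_size e_irr c_sym xp.
have chl := shortest_chordless e_sym c_sym xp p_min.
pose z (i : 'I_(size p)) : T := nth x p i.
have [pe pl ps] := xp.
have z_adj i : adj G (z i) (z (ordS i)).
  apply/asboolP; rewrite -/(e _ _) /z /=.
  have /(pathP x) ep := pe.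
  have [lt|ge] := ltnP i.+1 (size p); first by rewrite modn_small //; apply: ep lt.
  have -> : i = (size p).-1 :> nat by have := ltn_ord i; lia.
  rewrite prednK ?modnn ?nth_last ?pl; last by lia.
  by apply: (ep 0); lia.
have z_cyc : is_cycle G z.
  split=> //; split=> // i j ij; apply: val_inj; apply/eqP.
  by rewrite -(nth_uniq x (ltn_ord i) (ltn_ord j) up); apply/eqP.
have [p4|p3] := ltnP 3 (size p).
  have wlogij (i j : 'I_(size p)) : i < j -> adj G (z i) (z j) ->
      j = ordS i \/ i = ordS j.
    move=> ij /asboolP zij; have /chl := zij; rewrite ij ltn_ord => /(_ isT).
    move=> [ji|[i0 jp]]; [left|right]; apply: val_inj => /=.
      by rewrite -ji modn_small.
    by rewrite jp modnn.
  have [i [j [zij [/eqP ji /eqP ij]]]] := G_chordal _ _ p4 z_cyc.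
  have [lt|gt|E] := ltngtP i j.
  - by case: (wlogij i j lt zij).
  - by case: (wlogij j i gt (adj_sym zij)).
  - by move: zij; rewrite (val_inj E); apply: adj_irr.
move: p3 sp z_adj ps pl; rewrite /z {z z_cyc chl}.
case: (p) => [|a [|b [|d [|? ?]]]] //= _ _ z_adj ps pl.
have := c_tri a b d; have := z_adj ord0; have := z_adj (inord 1); have := z_adj (inord 2).
rewrite /= !inordK //= => da bd ab /(_ ab bd da).
by move: ps; rewrite -pl addbF; case: (c d a) (c a b) (c b d) => [] [] [].
Qed.

(** In an acyclic graph both conditions of [chordal_potential] are vacuous. On a
    cycle, the indicator function of a single edge has no potential, since a
    potential would be constant along the rest of the cycle. *)
Lemma acyclicP G : acyclic G <-> has_potentials G.
Proof.
split=> [Gac c c_sym|Gpot n z [n3 [z_inj z_adj]]].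
  apply: chordal_potential => // [n z _ /Gac //|x y w xy yw wx].
  by case: (Gac _ _ (triangle_cycle xy yw wx)).
case: n n3 z z_inj z_adj => // n n3 z z_inj z_adj.
pose c x y := `[< [set x; y] = [set z ord0; z (ordS ord0)] >].
have c_sym x y : c x y = c y x by rewrite /c setUC.
have [f fc] := Gpot c c_sym.
have pairE i j : [set z i; z j] = [set z ord0; z (ordS ord0)] -> (i <= 1) /\ (j <= 1).
  move=> E; split; [have : [set z i; z j] (z i) by left|have : [set z i; z j] (z j) by right];
  by rewrite E => -[] /z_inj ->; rewrite //= modn_small //; lia.
have step i : 0 < i < n -> f (z (inord i)) = f (z (inord i.+1)).
  move=> /andP[i0 lt]; have := fc _ _ (z_adj (inord i)).
  rewrite ordS_inord //.
  have -> : c (z (inord i)) (z (inord i.+1)) = false.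
    by apply/asboolP => /pairE[_]; rewrite inordK; lia.
  by case: (f _) (f _) => [] [].
have all1 i : 0 < i <= n -> f (z (inord 1)) = f (z (inord i)).
  by elim: i => // -[|i] IH //= le; rewrite IH; [apply: step; lia|lia].
have := fc _ _ (z_adj ord_max); have := fc _ _ (z_adj ord0).
have -> : ordS (ord0 : 'I_n.+1) = inord 1.
  by apply: val_inj; rewrite /= inordK ?modn_small //; lia.
have -> : ordS (ord_max : 'I_n.+1) = ord0 by apply: val_inj; rewrite /= modnn.
have -> : c (z ord_max) (z ord0) = false by apply/asboolP => /pairE[/=]; lia.
have -> : c (z ord0) (z (inord 1)) = true.
  apply/asboolP; congr [set _; z _]; apply: val_inj; rewrite /= inordK ?modn_small //; lia.
have -> : (ord_max : 'I_n.+1) = inord n by apply: val_inj; rewrite /= inordK.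
rewrite (all1 n) //; last by lia.
by case: (f _) (f _) => [] [].
Qed.

End Potentials.

(** * Unions and intersections of subtrees *)
Section Subtrees.
Variables (I T : Type).
Implicit Types (F A B G K : graph T) (J : set I) (P : I -> graph T).

Definition overlap A B : Prop := vset (gcap A B) !=set0.

Lemma acyclic_sub G K : subgraph K G -> acyclic G -> acyclic K.
Proof.
move=> [_ KE] /acyclicP Gac; apply/acyclicP => c /Gac[f fc].
by exists f => x y /KE/fc.
Qed.

(** The indicator function of the edge has a potential, which is locally
    constant once the edge is deleted. *)
Lemma acyclic_bridge G a b :
  acyclic G -> adj G a b -> ~ reachable (del_edge G a b) a b.
Proof.
move=> /acyclicP Gac ab; pose c x y := `[< [set x; y] = [set a; b] >].
have [f fc] : exists f, potential G c f by apply: Gac => x y; rewrite /c setUC.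
have := fc _ _ ab; rewrite /c (asboolT (erefl _)) => fab.
move=> /(locally_constant_reachable (f := f)) H; move: fab; rewrite H ?addbb //.
move=> x y [xy ne]; have := fc _ _ xy; rewrite /c (asboolF ne).
by case: (f x) (f y) => [] [].
Qed.

(** Let [f] be locally constant on the intersection, and let [u] be a potential
    of the coboundary of [f] on the edges of [A], extended by 0. Then [u + f] is
    constant on [A], while [u] is constant on [B], so that [f] is constant where
    both [A] and [B] are present. *)
Lemma connected_gcap F A B : acyclic F -> subgraph A F -> subgraph B F ->
  connected A -> connected B -> connected (gcap A B).
Proof.
move=> /acyclicP Fac [AV AE] [BV BE] /connectedP Ac /connectedP Bc.
apply/connectedP => f fAB x y [Ax Bx] [Ay By].
pose c x y := `[< adj A x y >] && (f x (+) f y).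
have [u uc] : exists u, potential F c u.
  apply: Fac => a b; rewrite /c addbC; congr (_ && _).
  by apply: asbool_equiv_eq; split; apply: adj_sym.
have uA : u x (+) f x = u y (+) f y.
  apply: (Ac (fun a => u a (+) f a)) => // a b ab.
  have := uc _ _ (AE _ _ ab); rewrite /c (asboolT ab).
  by case: (u a) (u b) (f a) (f b) => [] [] [] [].
have uB : u x = u y.
  apply: Bc => // a b ab; have := uc _ _ (BE _ _ ab); rewrite /c.
  case: asboolP => [Aab|_]; first rewrite (fAB a b) //= addbb.
    by case: (u a) (u b) => [] [].
  by case: (u a) (u b) => [] [].
by move: uA; rewrite uB; case: (u y) (f x) (f y) => [] [] [].
Qed.

Lemma chain_constant n (w : nat -> graph T) f :
  (forall i, i <= n -> connected (w i)) ->
  (forall i, i <= n -> locally_constant (w i) f) ->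
  (forall i, i < n -> overlap (w i) (w i.+1)) ->
  forall i x y, i <= n -> vset (w 0) x -> vset (w i) y -> f x = f y.
Proof.
move=> wc wf wm; elim=> [|i IH] x y le x0 yi.
  by have /connectedP := wc _ le; apply=> //; apply: wf.
have [z [zi zi1]] := wm _ le; rewrite (IH x z) ?(ltnW le) //.
by have /connectedP := wc _ le; apply=> //; apply: wf.
Qed.

(** The intersection of [B] with the union of the [P j] is connected and is
    covered by the intersections with [P p] and [P q]; every edge of it lies in
    one of the two, so the two share a vertex. *)
Lemma connected_two_overlaps F B J P p q :
  acyclic F -> subgraph B F -> subgraph (gbigcup J P) F ->
  connected B -> connected (gbigcup J P) ->
  J p -> J q -> overlap (P p) B -> overlap (P q) B ->
  (forall j, J j -> overlap (P j) B -> j = p \/ j = q) ->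
  overlap (P p) (P q).
Proof.
move=> Fac BF PF Bc Pc Jp Jq [x [px Bx]] [y [qy By]] only.
apply: contrapT => disj.
have /connectedP cap := connected_gcap Fac PF BF Pc Bc.
have : `[< vset (P p) x >] = `[< vset (P p) y >].
  apply: (cap (fun a => `[< vset (P p) a >]));
    [|by split=> //; exists p|by split=> //; exists q].
  move=> a b [[j Jj ab] Bab].
  have [E|E] : j = p \/ j = q.
    by apply: only => //; exists a; split; [apply: adj_vset ab | apply: adj_vset Bab].
    rewrite -{}E in disj *.
    by rewrite !asboolT //; [apply: adj_vsetr ab | apply: adj_vset ab].
  rewrite -{}E in disj.
  rewrite !asboolF // => H; apply: disj; [exists b|exists a]; split=> //.
    exact: adj_vsetr ab.
  exact: adj_vset ab.
by rewrite (asboolT px) => /esym/asboolP H; apply: disj; exists y.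
Qed.

(** Potentials are functions on vertices, so a family that agrees on common
    vertices has a common extension. *)
Lemma glue_potentials J P c (f : I -> T -> bool) :
  (forall i, J i -> potential (P i) c (f i)) ->
  (forall i j x, J i -> J j -> vset (P i) x -> vset (P j) x -> f i x = f j x) ->
  exists g, potential (gbigcup J P) c g.
Proof.
move=> fc agree; pose g x := `[< exists i, [/\ J i, vset (P i) x & f i x] >].
have gE i x : J i -> vset (P i) x -> g x = f i x.
  move=> Ji ix; rewrite /g; case: asboolP => [[j [Jj jx <-]]|H]; first exact: agree.
  by case E: (f i x) => //; case: H; exists i.
exists g => x y [i Ji xy].
by rewrite (gE i x) ?(gE i y) //; [apply: fc | apply: adj_vsetr xy | apply: adj_vset xy].
Qed.

(** The nerve lemma in dimension one. Potentials of [c] on [P i] and [P j] differ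
    by a constant [g i j] on their connected intersection; a common vertex of
    three of the graphs shows that [g] vanishes around triangles of [L]; and a
    potential of [g] on the chordal graph [L] corrects the chosen potentials so
    that they can be glued. *)
Lemma acyclic_nerve (L : graph I) P : chordal L ->
  (forall i, vset L i -> acyclic (P i)) ->
  (forall i j, vset L i -> vset L j -> i <> j -> overlap (P i) (P j) -> adj L i j) ->
  (forall i j, adj L i j -> connected (gcap (P i) (P j)) /\ overlap (P i) (P j)) ->
  (forall i j k, adj L i j -> adj L j k -> adj L k i ->
     exists x, [/\ vset (P i) x, vset (P j) x & vset (P k) x]) ->
  acyclic (gbigcup (vset L) P).
Proof.
move=> L_chordal Pac meet_adj adj_meet triple; apply/acyclicP => c c_sym.
have /choice[f fc] : forall i, exists f, vset L i -> potential (P i) c f.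
  move=> i; have [Li|nLi] := pselect (vset L i); last by exists xpredT.
  by have /acyclicP/(_ c c_sym)[f fc] := Pac i Li; exists f.
pose g i j := `[< exists x, [/\ vset (P i) x, vset (P j) x & f i x (+) f j x] >].
have g_sym i j : g i j = g j i.
  by apply: asbool_equiv_eq; split=> -[x [xi xj]]; exists x; rewrite addbC.
have gE i j x : adj L i j -> vset (P i) x -> vset (P j) x ->
    g i j = f i x (+) f j x.
  move=> ij xi xj; have [/connectedP cap _] := adj_meet _ _ ij.
  have Li := adj_vset ij; have Lj := adj_vsetr ij.
  have const y : vset (P i) y -> vset (P j) y ->
      f i x (+) f j x = f i y (+) f j y.
    move=> yi yj; apply: (cap (fun a => f i a (+) f j a)) => // a b [iab jab].
    have := fc _ Li _ _ iab; rewrite -(fc _ Lj _ _ jab).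
    by case: (f i a) (f j a) (f i b) (f j b) => [] [] [] [].
  rewrite /g; case: asboolP => [[y [yi yj yf]]|H]; first by rewrite (const y).
  by case E: (_ (+) _) => //; case: H; exists x.
have [k kg] : exists k, potential L g k.
  apply: chordal_potential => // i j l ij jl li.
  have [x [xi xj xl]] := triple _ _ _ ij jl li.
  rewrite (gE i j x) ?(gE j l x) ?(gE l i x) //.
  by case: (f i x) (f j x) (f l x) => [] [] [].
apply: (glue_potentials (f := fun i x => f i x (+) k i)) => [i Li x y xy|i j x Li Lj xi xj].
  by rewrite -(fc i Li x y xy); case: (f i x) (f i y) (k i) => [] [] [].
have [->//|ij] := pselect (i = j).
have Lij : adj L i j by apply: meet_adj => //; exists x.
have := kg _ _ Lij; rewrite (gE _ _ x) //.
by case: (f i x) (f j x) (k i) (k j) => [] [] [] [].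
Qed.

End Subtrees.

(** Subtrees of a tree have a chordal intersection graph, stated for a closed
    sequence of subtrees: if the first one met only its two neighbours in the
    sequence, these two would meet each other by [connected_two_overlaps]. *)
Lemma subtrees_cycle_chord T n (F : graph T) (P : 'I_n -> graph T) :
  3 < n -> acyclic F ->
  (forall i, subgraph (P i) F /\ connected (P i)) ->
  (forall i, overlap (P i) (P (ordS i))) ->
  exists i j, [/\ i <> j, j <> ordS i, i <> ordS j & overlap (P i) (P j)].
Proof.
case: n P => // n P n3 Fac PF Pm; apply: contrapT => none.
have ordE (j : 'I_n.+1) : j = inord j by apply: val_inj; rewrite /= inordK.
pose J := [set j : 'I_n.+1 | j <> inord 0].
apply: (none); exists (inord 1), (inord n); rewrite ordS_inord ?ordS_inord_max; last by lia.
split; try by apply: inord_neq; lia.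
apply: (@connected_two_overlaps _ _ F (P (inord 0)) J) => //.
- by have [] := PF (inord 0).
- by split=> [x [j _ jx]|x y [j _ jxy]]; have [[PV PE] _] := PF j; [apply: PV | apply: PE].
- by have [] := PF (inord 0).
- apply/connectedP => f fP.
  have [x0 [x0_1 _]] := Pm (inord 1).
  suff H x : vset (gbigcup J P) x -> f x0 = f x by move=> x y /H <- /H.
  move=> [j Jj jx]; have j0 : 0 < j.
    by rewrite lt0n; apply/eqP => j0; apply: Jj; rewrite (ordE j) j0.
  apply: (@chain_constant _ n.-1 (fun k => P (inord k.+1)) _ _ _ _ j.-1) => //.
  + by move=> i _; have [] := PF (inord i.+1).
  + move=> i lt a b ab; apply: fP; exists (inord i.+1) => //.
    by apply: inord_neq; lia.
  + by move=> i lt; have := Pm (inord i.+1); rewrite ordS_inord //; lia.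
  + by have := ltn_ord j; lia.
  + by rewrite prednK // -ordE.
- by apply: inord_neq; lia.
- by apply: inord_neq; lia.
- by have [x [x0 x1]] := Pm (inord 0); rewrite ordS_inord in x1; [exists x | lia].
- by have [x [xn x0]] := Pm (inord n); rewrite ordS_inord_max in x0; exists x.
- move=> j Jj jm; apply: contrapT => /not_orP[j1 jn]; apply: none.
  exists (inord 0), j; split=> //.
  + by move=> E; apply: Jj; rewrite E.
  + by rewrite ordS_inord //; lia.
  + move=> E; apply: jn; rewrite (ordE j); congr inord.
    move/(congr1 val): E; rewrite /= inordK // => E.
    by have := ltn_ord j; rewrite ltnS leq_eqVlt => /orP[/eqP //|lt]; rewrite modn_small in E.
  + by case: jm => x [xj x0]; exists x.
Qed.

(** * Walks, distances and neighbourhoods *)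
Section Distances.
Variable T : Type.
Implicit Types (G : graph T) (u v : T).

Lemma walk_distance G u v m w : walk G m w -> w 0 = u -> w m = v ->
  exists2 d, d <= m & at_distance G u v d.
Proof.
move=> wm w0 wE.
have ex : exists n, `[< exists w, walk G n w /\ w 0 = u /\ w n = v >].
  by exists m; apply/asboolP; exists w.
case: (ex_minnP ex) => d /asboolP dw dmin; exists d; last split=> //.
  by apply: dmin; apply/asboolP; exists w.
by move=> n w' wn wn0 wnn; apply: dmin; apply/asboolP; exists w'.
Qed.

Lemma open_nbhdP G r v u : open_nbhd G r v u <->
  exists d w, [/\ walk G d w, w 0 = u, w d = v & 2 * d < r].
Proof.
split=> [[d [[w [wW [w0 wd]]] _] dr]|[d [w [wW w0 wd dr]]]]; first by exists d, w.
by have [d' le dd] := walk_distance wW w0 wd; exists d' => //; lia.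
Qed.

Lemma walk_drop G n w i : i <= n -> walk G n w -> walk G (n - i) (fun k => w (k + i)).
Proof. by move=> le [wV wE]; split=> k kn; [apply: wV; lia | apply: wE; lia]. Qed.

Lemma walk_open_nbhd G r v n w i : walk G n w -> w n = v -> i <= n -> 2 * (n - i) < r ->
  open_nbhd G r v (w i).
Proof.
move=> wW wn le lt; apply/open_nbhdP; exists (n - i), (fun k => w (k + i)).
by rewrite subnK //; split=> //; apply: walk_drop.
Qed.

Lemma open_nbhd_center G r v : 0 < r -> vset G v -> open_nbhd G r v v.
Proof. by move=> r0 Gv; apply/open_nbhdP; exists 0, (fun=> v); rewrite muln0; split. Qed.

Lemma open_closed G r v u : open_nbhd G r v u -> closed_nbhd G r v u.
Proof. by move=> [d ud dr]; exists d => //; apply: ltnW. Qed.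

Lemma closed_vset G r v u : closed_nbhd G r v u -> vset G u.
Proof. by move=> [d [[w [[wV _] [<- _]]] _] _]; apply: wV. Qed.

Lemma walk_join G m n w w' : walk G m w -> walk G n w' -> w m = w' n ->
  exists j, [/\ walk G (m + n) j, forall i, i <= m -> j i = w i &
    forall i, i <= n -> j (m + n - i) = w' i].
Proof.
move=> [wV wE] [w'V w'E] wm; pose j i := if i <= m then w i else w' (m + n - i).
have j2 i : m <= i -> i <= m + n -> j i = w' (m + n - i).
  move=> mi le; rewrite /j; case: leqP => // im.
  have -> : i = m by lia.
  by rewrite wm addKn.
exists j; split.
- split=> i le; rewrite /j.
    by case: (leqP i m) => im; [apply: wV | apply: w'V; lia].
  case: (ltnP i m) => im; first by rewrite ltnW //; apply: wE.
  rewrite -/(j i) j2 //; last by apply: ltnW.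
  have -> : m + n - i = (m + n - i.+1).+1 by lia.
  by apply: adj_sym; apply: w'E; lia.
- by move=> i im; rewrite /j im.
- move=> i ni; rewrite j2; try lia.
  by congr w'; lia.
Qed.

End Distances.

(** * Acyclic decompositions induce tree-decompositions of balls *)
Section AcyclicDecomposition.
Variables (T U : Type) (G : graph T) (H : graph U) (bag : U -> set T).
Variables (part : T -> graph U) (r : nat).
Hypothesis dec : graph_decomposition G H bag part.

Lemma part_node v h : vset G v -> vset (part v) h <-> vset H h /\ bag h v.
Proof.
move=> Gv; have [_ [_ [_ /(_ v Gv)[_ [_ ->]]]]] := dec.
by split=> [[_ //]|[Hh hv]]; split.
Qed.

Lemma part_adj v x y : vset G v -> adj (part v) x y -> adj H x y /\ bag x v /\ bag y v.
Proof.
move=> Gv xy; have [_ [_ [_ /(_ v Gv)[_ [[_ sub] _]]]]] := dec.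
by have [? [[_ ?] [_ ?]]] := sub _ _ xy.
Qed.

Lemma part_connected v : vset G v -> connected (part v).
Proof. by move=> Gv; have [_ [_ [_ /(_ v Gv)[]]]] := dec. Qed.

Lemma part_nonempty v : vset G v -> vset (part v) !=set0.
Proof.
move=> Gv; have [_ [[[sub _] _] _]] := dec.
by have [h Hh [_ hv]] := sub _ Gv; exists h; apply/part_node.
Qed.

Lemma adj_common_node u v : adj G u v -> exists h, [/\ vset H h, bag h u & bag h v].
Proof.
move=> uv; have [_ [[[_ sub] _] _]] := dec.
by have [h Hh [_ [hu hv]]] := sub _ _ uv; exists h.
Qed.

Lemma part_overlap u v : adj G u v -> overlap (part u) (part v).
Proof.
move=> uv; have [h [Hh hu hv]] := adj_common_node uv.
exists h; split; apply/part_node => //; [exact: adj_vset uv | exact: adj_vsetr uv].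
Qed.

Lemma walk_parts_connected n w : walk G n w ->
  connected (gbigcup [set w i | i in `I_n.+1] part).
Proof.
move=> [wV wE]; apply/connectedP => f fP.
have [x0 x0_0] := part_nonempty (wV 0 (leq0n n)).
suff K x : vset (gbigcup [set w i | i in `I_n.+1] part) x -> f x0 = f x.
  by move=> x y /K <- /K.
move=> [_ [i /= le <-] ix]; apply: (@chain_constant _ n (part \o w) _ _ _ _ i) => //.
- by move=> k le'; apply: part_connected; apply: wV.
- by move=> k le' a b ab; apply: fP; exists (w k) => //; exists k.
- by move=> k lt; apply: part_overlap; apply: wE.
Qed.

Hypothesis rac : r_acyclic G part r.

(** The small sets of vertices to which acyclicity is applied are traces of
    finite sequences, of which only the length is controlled. *)
Lemma small_parts_acyclic n (w : nat -> T) (X : set T) : n <= r ->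
  (forall i, i < n -> vset G (w i)) -> X `<=` [set w i | i in `I_n] ->
  acyclic (gbigcup X part).
Proof.
move=> nr wV Xw; apply: rac => [x /Xw[i /= lt <-]|]; first exact: wV.
apply: card_le_trans (subset_card_le Xw) _.
apply: card_le_trans (card_image_le _ _) _.
by rewrite card_le_II.
Qed.

Lemma walk_parts_acyclic n w : n < r -> walk G n w ->
  acyclic (gbigcup [set w i | i in `I_n.+1] part).
Proof. by move=> nr [wV _]; apply: (small_parts_acyclic nr wV). Qed.

Lemma vertex_acyclic v : 0 < r -> vset G v -> acyclic (part v).
Proof.
move=> r0 Gv; apply: (@acyclic_sub _ (gbigcup [set v] part)).
  by split=> [x|x y] ?; exists v.
apply: (@small_parts_acyclic 1 (fun=> v)) => // x ->; by exists 0.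
Qed.

(** For each vertex [u] at distance less than r/2 from [v] choose a walk of
    length less than r/2 from [u] to [v]. The co-parts of the vertices on this
    walk have a potential that is 0 at a fixed node of the co-part of [v]. Two
    such walks together have at most [r] vertices, so both potentials come from
    one potential on the co-parts of both walks, and they agree wherever both
    are defined. *)
Lemma local_host_acyclic v : 0 < r -> vset G v -> acyclic (local_host G part r v).
Proof.
move=> r0 Gv; apply/acyclicP => c c_sym.
have [hv vhv] := part_nonempty Gv.
have /choice[s sP] : forall u, exists s : nat * (nat -> T) * (U -> bool), open_nbhd G r v u ->
  [/\ walk G s.1.1 s.1.2, s.1.2 0 = u, s.1.2 s.1.1 = v, 2 * s.1.1 < r &
    potential (gbigcup [set s.1.2 i | i in `I_s.1.1.+1] part) c s.2 /\ s.2 hv = false].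
  move=> u; have [|no] := pselect (open_nbhd G r v u); last by exists (0, fun=> u, xpredT).
  move=> /open_nbhdP[d [w [wW w0 wd dr]]].
  have /acyclicP/(_ c c_sym)[f fc] : acyclic (gbigcup [set w i | i in `I_d.+1] part).
    by apply: walk_parts_acyclic => //; lia.
  exists (d, w, fun x => f x (+) f hv) => _; split=> //=; split; last by rewrite addbb.
  by move=> x y /fc <-; case: (f x) (f y) (f hv) => [] [] [].
apply: (glue_potentials (f := fun u => (s u).2)) => [u /sP|u u' h /sP + /sP].
  move: (s u) => [[d w] f] /= [_ w0 _ _ [fc _]] x y xy.
  by apply: fc; exists u => //; exists 0.
move: (s u) (s u') => [[d w] f] [[d' w'] f'] /=.
move=> [wW w0 wd dr [fc fv]] [wW' w0' wd' dr' [fc' fv']] uh uh'.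
have [|j [jW jw jw']] := walk_join wW wW'; first by rewrite wd wd'.
have /acyclicP/(_ c c_sym)[F Fc] : acyclic (gbigcup [set j i | i in `I_(d + d').+1] part).
  by apply: walk_parts_acyclic => //; lia.
(* On each of the two walks, F differs from the chosen potential by a constant,
   which is read off at hv. *)
have compare e z k : walk G e z -> z e = v ->
    (forall i, i <= e -> exists2 l, l <= d + d' & j l = z i) ->
    potential (gbigcup [set z i | i in `I_e.+1] part) c k -> k hv = false ->
    vset (part (z 0)) h ->
    k h = F h (+) F hv.
  move=> zW ze zj kc kv zh.
  suff : k h (+) F h = k hv (+) F hv by rewrite kv; case: (k h) (F h) (F hv) => [] [] [].
  have /connectedP conn := walk_parts_connected zW.
  apply: (conn (fun a => k a (+) F a)).
  - move=> x y xy; have := kc _ _ xy; rewrite -(Fc x y).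
      by case: (k x) (F x) (k y) (F y) => [] [] [] [].
    move: xy => [_ [i /= lt <-] xy]; have [l ll E] := zj i lt.
    by exists (j l); [exists l | rewrite E].
  - by exists (z 0) => //; exists 0.
  - by exists (z e); [exists e => /= | rewrite ze].
rewrite (compare d w f) ?(compare d' w' f') ?w0 ?w0' //.
  by move=> i ii; exists (d + d' - i); [lia | apply: jw'].
by move=> i ii; exists i; [lia | apply: jw].
Qed.

Lemma local_host_connected v : 0 < r -> vset G v -> connected (local_host G part r v).
Proof.
move=> r0 Gv; apply/connectedP => f fP; have [hv vhv] := part_nonempty Gv.
suff K x : vset (local_host G part r v) x -> f x = f hv.
  by move=> x y /K -> /K ->.
move=> [u /open_nbhdP[d [w [wW w0 wd dr]]] ux].
have /connectedP conn := walk_parts_connected wW; apply: conn.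
- move=> a b [_ [i /= le <-] ab]; apply: fP; exists (w i) => //.
  by apply: (walk_open_nbhd wW) => //; lia.
- by exists (w 0); [exists 0 | rewrite w0].
- by exists (w d); [exists d => /= | rewrite wd].
Qed.

(** Only vertices [u] at distance exactly r/2 need an argument. Two nodes of the
    intersection lie in co-parts of vertices closer to [v], and short walks from
    these to [v] together with [u] have at most [r] vertices; then
    [connected_gcap] applies to the co-part of [u] and the union of the co-parts
    along both walks. *)
Lemma local_part_connected v u : 0 < r -> vset G v -> closed_nbhd G r v u ->
  connected (local_part G part r v u).
Proof.
move=> r0 Gv cu; have Gu := closed_vset cu.
rewrite /local_part; case: asboolP => [_|nou]; first exact: part_connected.
have [D uD Dr] := cu.
have rD : r <= 2 * D by rewrite leqNgt; apply/negP => lt; apply: nou; exists D.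
apply/connectedP => f fP x y [ux [a /open_nbhdP[d [w [wW w0 wd dr]]] ax]].
move=> [uy [b /open_nbhdP[d' [w' [wW' w0' wd' dr']]] bx]].
have [|j [jW jw jw']] := walk_join wW wW'; first by rewrite wd wd'.
pose J := [set j i | i in `I_(d + d').+1].
have Jopen c : J c -> open_nbhd G r v c.
  move=> [i /= le <-]; have [id|di] := leqP i d.
    by rewrite jw //; apply: (walk_open_nbhd wW) => //; lia.
  have -> : j i = w' (d + d' - i) by rewrite -jw'; [congr j|]; lia.
  by apply: (walk_open_nbhd wW') => //; lia.
have Fac : acyclic (gbigcup (u |` J) part).
  apply: (@small_parts_acyclic (d + d').+2 (fun i => if i is k.+1 then j k else u)).
  - by lia.
  - by move=> [|i] lt //; have [jV _] := jW; apply: jV.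
  - by move=> c [->|[i /= le <-]]; [exists 0 | exists i.+1].
have uF : subgraph (part u) (gbigcup (u |` J) part).
  by split=> [h|h h'] ?; exists u => //; left.
have JF : subgraph (gbigcup J part) (gbigcup (u |` J) part).
  by split=> [h|h h'] [c Jc hc]; exists c => //; right.
have /connectedP cap := connected_gcap Fac uF JF (part_connected Gu) (walk_parts_connected jW).
apply: cap.
- move=> h h' [uh [c Jc ch]]; apply: fP; split=> //; exists c => //; exact: Jopen.
- by split=> //; exists a => //; exists 0; rewrite ?jw ?w0.
- by split=> //; exists b => //; exists (d + d'); [exact: ltnSn | rewrite -w0' -jw' // subn0].
Qed.

Lemma closed_common_open_node v u : 1 < r -> vset G v -> closed_nbhd G r v u ->
  exists2 w, open_nbhd G r v w & overlap (part w) (part u).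
Proof.
move=> r1 Gv cu; have [ou|nou] := pselect (open_nbhd G r v u).
  by exists u => //; have [h uh] := part_nonempty (closed_vset cu); exists h.
have [d [[w [[wV wE] [w0 wd]]] _] dr] := cu.
case: d => [|d] in dr wV wE wd *.
  by case: nou; rewrite -w0 wd; apply: open_nbhd_center => //; apply: ltnW.
exists (w 1); last first.
  by rewrite -w0; apply: part_overlap; apply: adj_sym; apply: wE.
by apply: (@walk_open_nbhd _ _ _ _ d.+1) => //; lia.
Qed.

Lemma locally_induces : 1 < r -> locally_induces_tree_decompositions G bag part r.
Proof.
move=> r1 v Gv; have r0 : 0 < r by apply: ltnW.
have ov := open_nbhd_center r0 Gv.
have hostH h : vset (local_host G part r v) h -> vset H h.
  by move=> [w ow] /(part_node _ (closed_vset (open_closed ow)))[].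
have lpE u : closed_nbhd G r v u ->
    spanning_subgraph (local_part G part r v u)
      (full_part (local_host G part r v) (local_bag G bag r v) u).
  move=> cu; have Gu := closed_vset cu; rewrite /local_part.
  case: asboolP => ou; split; try split.
  - move=> h uh; have [Hh hu] := (part_node h Gu).1 uh.
    by do !split=> //; exists u.
  - move=> x y xy; have [_ [xu yu]] := part_adj Gu xy.
    have hx : vset (local_host G part r v) x by exists u => //; apply: adj_vset xy.
    have hy : vset (local_host G part r v) y by exists u => //; apply: adj_vsetr xy.
    by split; [exists u | do !split].
  - apply/seteqP; split=> h; first move=> uh.
      have [Hh hu] := (part_node h Gu).1 uh; by do !split=> //; exists u.
    by move=> [hh [_ [hu _]]]; apply/(part_node _ Gu); split=> //; apply: hostH.
  - move=> h [uh hh]; have [Hh hu] := (part_node h Gu).1 uh; by do !split.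
  - move=> x y [xy hxy]; have [_ [xu yu]] := part_adj Gu xy.
    by split=> //; do !split=> //; [exact: adj_vset hxy | exact: adj_vsetr hxy].
  - apply/seteqP; split=> h; first by move=> [/(part_node _ Gu)[_ hu] hh].
    by move=> [hh [_ [hu _]]]; split=> //; apply/(part_node _ Gu); split=> //; apply: hostH.
split; last first.
  split; first by have [h vh] := part_nonempty Gv; exists h, v.
  by split; [apply: local_host_connected | apply: local_host_acyclic].
split; [by move=> h _ u [_ cu]|split; [split; split|split]].
- move=> u cu; have [w ow [h [wh uh]]] := closed_common_open_node r1 Gv cu.
  have [_ hu] := (part_node h (closed_vset cu)).1 uh.
  by exists h; [exists w | split].
- move=> x y xyB; have [xy [a [b [xa [yb abr]]]]] := xyB.
  have [h [Hh hx hy]] := adj_common_node xy.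
  exists h; last first.
    split=> //; split; split=> //; [exact: adj_vset xyB | exact: adj_vsetr xyB].
  have [ar|br] : 2 * a < r \/ 2 * b < r by lia.
    by exists x; [exists a | apply/part_node => //; apply: adj_vset xy].
  by exists y; [exists b | apply/part_node => //; apply: adj_vsetr xy].
- by move=> u [h _ [cu _]].
- by move=> x y [h _ []].
- move=> u cu; have [_ E] := lpE _ cu.
  move: (local_part_connected r0 Gv cu) => /connectedP conn; apply/connectedP => f fP.
  by rewrite -E; apply: conn; apply: locally_constant_sub fP; have [] := lpE _ cu.
- by move=> u cu; split; [apply: local_part_connected | apply: lpE].
Qed.

End AcyclicDecomposition.

(** * Tree-decompositions of balls make the balls chordal *)
Section ChordalBalls.
Variables (T U : Type) (G : graph T) (H : graph U) (bag : U -> set T).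
Variables (part : T -> graph U) (r : nat).

Lemma walk_cons n w x :
  walk G n w -> adj G x (w 0) -> walk G n.+1 (fun i => if i is k.+1 then w k else x).
Proof.
move=> [wV wE] xw; split=> [[_|i]|[_|i]] //=; [exact: adj_vset xw|exact: wV|exact: wE].
Qed.

Lemma open_nbhd_adj v x y : adj G x y -> open_nbhd G (r - 2) v y -> open_nbhd G r v x.
Proof.
move=> xy /open_nbhdP[d [w [wW w0 wd dr]]]; apply/open_nbhdP.
by exists d.+1, (fun i => if i is k.+1 then w k else x); split=> //;
  [apply: walk_cons; rewrite ?w0 | lia].
Qed.

Hypothesis dec : graph_decomposition G H bag part.
Hypothesis cliques : into_cliques G H bag.
Hypothesis r2 : 2 < r.
Hypothesis loc : locally_induces_tree_decompositions G bag part r.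

Section Ball.
Variable v : T.
Hypothesis Gv : vset G v.

Let host := local_host G part r v.
Let P := local_part G part r v.
Let td : graph_decomposition (ball G r v) host (local_bag G bag r v) P := (loc Gv).1.
Let host_acyclic : acyclic host := (loc Gv).2.2.2.

Let P_sub u : closed_nbhd G r v u -> subgraph (P u) host.
Proof.
move=> cu; split=> [h|h h']; first by move=> /(part_node td _ cu)[].
by move=> /(part_adj td cu)[].
Qed.

(** Bags are cliques of [G], but not of the ball: two vertices at distance
    exactly r/2 from [v] may share a bag without being adjacent in the ball.
    This is why one of the two vertices has to be closer. *)
Lemma overlap_ball_adj x y : open_nbhd G r v x -> closed_nbhd G r v y -> x <> y ->
  overlap (P x) (P y) -> adj (ball G r v) x y.
Proof.
move=> ox cy xy [h [xh yh]]; have cx := open_closed ox.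
have [[u ou uh] [hx _]] := (part_node td h cx).1 xh.
have [_ [hy _]] := (part_node td h cy).1 yh.
have [Hh _] := (part_node dec h (closed_vset (open_closed ou))).1 uh.
split; first by apply: (cliques Hh).2.
by have [a xa ar] := ox; have [b yb br] := cy; exists a, b; split=> //; split=> //; lia.
Qed.

Lemma ball_adj_open x y : adj (ball G r v) x y -> ~ open_nbhd G r v x -> open_nbhd G r v y.
Proof.
move=> [_ [a [b [xa [yb abr]]]]] nx; exists b => //.
have [//|br] := ltnP (2 * b) r; case: nx; exists a => //; lia.
Qed.

(** A vertex at distance exactly r/2 from [v] is simplicial in the ball: its
    neighbours [p] and [q] can be joined through [v] by vertices that are too
    close to [v] to be adjacent to it, so [connected_two_overlaps] applies. *)
Lemma sphere_neighbours_overlap x p q : closed_nbhd G r v x -> ~ open_nbhd G r v x ->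
  adj (ball G r v) x p -> adj (ball G r v) x q -> overlap (P p) (P q).
Proof.
move=> cx nx xp xq; have op := ball_adj_open xp nx; have oq := ball_adj_open xq nx.
(* The vertices at distance less than r/2 - 1 from v are not adjacent to x. *)
pose J := [set p; q] `|` open_nbhd G (r - 2) v.
have open_J u : J u -> open_nbhd G r v u.
  move=> [[->|->] //|[d ud dr]]; exists d => //; lia.
have J_walk u : open_nbhd G r v u -> J u ->
    exists d w, [/\ walk G d w, w 0 = u, w d = v & forall i, i <= d -> J (w i)].
  move=> /open_nbhdP[d [w [wW w0 wd dr]]] Ju; exists d, w; split=> // -[|i] id.
    by rewrite w0.
  have [D xD Dr] := cx; have ge : r <= 2 * D.
    by rewrite leqNgt; apply/negP => lt; apply: nx; exists D.
  by right; apply: (walk_open_nbhd wW) => //; lia.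
have Jv : J v by right; apply: open_nbhd_center => //; lia.
apply: (@connected_two_overlaps _ _ host (P x) J) => //.
- exact: P_sub.
- split=> [h|h h'] [u Ju uh]; have [PV PE] := P_sub (open_closed (open_J u Ju)).
    exact: PV.
  exact: PE.
- exact: part_connected td _ cx.
- have [h0 h0v] := part_nonempty td (open_closed (open_J _ Jv)).
  apply/connectedP => f fP; suff K h : vset (gbigcup J P) h -> f h = f h0.
    by move=> h h' /K -> /K ->.
  move=> [u Ju uh]; have [d [w [[wV wE] w0 wd wJ]]] := J_walk u (open_J _ Ju) Ju.
  have clJ i : i <= d -> closed_nbhd G r v (w i).
    by move=> id; apply: open_closed; apply: open_J; apply: wJ.
  apply: (@chain_constant _ d (P \o w) _ _ _ _ d) => //=; rewrite ?w0 ?wd //.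
  + by move=> i id; apply: (part_connected td); apply: clJ.
  + by move=> i id a b ab; apply: fP; exists (w i) => //; apply: wJ.
  + move=> i id; apply: (part_overlap td); split; first exact: wE.
    have [a wa ar] := open_J _ (wJ _ (ltnW id)); have [b wb br] := open_J _ (wJ _ id).
    by exists a, b; split=> //; split=> //; lia.
- by left; left.
- by left; right.
- by apply: (part_overlap td); apply: adj_sym.
- by apply: (part_overlap td); apply: adj_sym.
- move=> j [[->|->]|oj] jx; [by left|by right|case: nx].
  have [E|ne] := pselect (j = x); first by rewrite -E; apply: open_J; right.
  have [xj _] := overlap_ball_adj (open_J j (or_intror oj)) cx ne jx.
  exact: open_nbhd_adj (adj_sym xj) oj.
Qed.

(** A cycle through a vertex at distance exactly r/2 has a chord by
    [sphere_neighbours_overlap]; on the other cycles, being adjacent in the ball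
    is the same as having overlapping co-parts. *)
Lemma ball_chordal : chordal (ball G r v).
Proof.
move=> n z n4 [_ [z_inj z_adj]].
have cz i : closed_nbhd G r v (z i) by exact: adj_vset (z_adj i).
have [all_open|[k nk]] : (forall i, open_nbhd G r v (z i)) \/
    exists i, ~ open_nbhd G r v (z (ordS i)).
  have [[k nk]|no] := pselect (exists i, ~ open_nbhd G r v (z (ordS i))).
    by right; exists k.
  by left=> i; apply: contrapT => ni; apply: no; exists (ord_pred i); rewrite ord_predK.
- have [i|i|i [j [ij ji1 ij1 ov]]] := @subtrees_cycle_chord _ _ host (P \o z) n4 host_acyclic.
  + by split; [apply: P_sub | apply: (part_connected td)]; apply: cz.
  + by apply: (part_overlap td); apply: z_adj.
  exists i, j; split; last by split; apply/eqP.
  by apply: overlap_ball_adj => // /z_inj.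
- have ov : overlap (P (z k)) (P (z (ordS (ordS k)))).
    by apply: sphere_neighbours_overlap (cz (ordS k)) nk _ _; [apply: adj_sym|].
  have ok : open_nbhd G r v (z k) by apply: ball_adj_open nk; apply: adj_sym.
  exists k, (ordS (ordS k)); split; last split.
  + by apply: overlap_ball_adj => // /z_inj/esym; apply: (@iter_ordS_neq n 2); lia.
  + by apply/eqP; apply: (@iter_ordS_neq n 1); lia.
  + by apply/eqP => /esym; apply: (@iter_ordS_neq n 3); lia.
Qed.

End Ball.
End ChordalBalls.

Lemma locally_chordal_of_decomposition T U (G : graph T) (H : graph U) bag part r :
  2 < r -> graph_decomposition G H bag part -> into_cliques G H bag ->
  locally_induces_tree_decompositions G bag part r -> locally_chordal G r.
Proof. by move=> r2 dec cl loc v Gv; apply: (ball_chordal dec cl r2 loc Gv). Qed.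

(** * From chordal balls to short holes and wheels *)

(** The second condition says that [G] has no induced wheel with at least 4
    spokes. *)
Definition hole_wheel_free T (G : graph T) (r : nat) : Prop :=
  (forall n (z : 'I_n -> T), 3 < n <= r -> is_cycle G z -> has_chord G z) /\
  (forall v, chordal (induced G [set w | adj G v w])).

Section FromBalls.
Variables (T : Type) (G : graph T) (r : nat).
Hypothesis r2 : 2 < r.
Hypothesis loc : locally_chordal G r.

Lemma ball_adj_of_walks v x y m n w w' : adj G x y ->
  walk G m w -> w 0 = x -> w m = v -> walk G n w' -> w' 0 = y -> w' n = v ->
  m + n < r -> adj (ball G r v) x y.
Proof.
move=> xy wW w0 wm w'W w'0 w'n mn.
have [a am xa] := walk_distance wW w0 wm; have [b bn yb] := walk_distance w'W w'0 w'n.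
by split=> //; exists a, b; split=> //; split=> //; lia.
Qed.

Lemma ball_cycle_chord v n (z : 'I_n -> T) : vset G v -> 3 < n -> is_cycle G z ->
  (forall i, adj (ball G r v) (z i) (z (ordS i))) -> has_chord G z.
Proof.
move=> Gv n4 [n3 [z_inj _]] zB.
have [|i [j [[ij _] ne]]] := loc Gv n4 (c := z); first by split.
by exists i, j.
Qed.

(** A cycle of length at most [r] lies in the ball around any of its vertices
    [z 0]: the two arcs from the ends of an edge to [z 0] have total length less
    than [r]. All edges between neighbours of [v] lie in the ball around [v],
    because 1 + 1 < r. *)
Lemma hole_wheel_free_of_balls : hole_wheel_free G r.
Proof.
split=> [[//|n] z /andP[n4 nr] z_cyc|v n z n4 [n3 [z_inj z_adj]]].
  have [_ [_ z_adj]] := z_cyc; pose zz i := z (inord (i %% n.+1)).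
  have zzE (i : 'I_n.+1) : z i = zz i by rewrite /zz ord_inord_mod.
  have zzA i : adj G (zz i) (zz i.+1) by rewrite /zz -ordS_inord_mod.
  have zzV i : vset G (zz i) by apply: adj_vset (zzA i).
  apply: (@ball_cycle_chord (zz 0)) => // i.
  have -> : z (ordS i) = zz i.+1 by rewrite /zz -ordS_inord_mod ord_inord_mod.
  rewrite zzE; have lt := ltn_ord i.
  apply: (@ball_adj_of_walks _ _ _ i (n - i) (fun k => zz (i - k)) (fun k => zz (i.+1 + k))) => //.
  - split=> k le //; have -> : i - k = (i - k.+1).+1 by lia.
    exact: adj_sym.
  - by rewrite subn0.
  - by rewrite subnn.
  - by split=> k le //; rewrite addnS.
  - by rewrite addn0.
  - have -> : i.+1 + (n - i) = n.+1 by lia.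
    by rewrite /zz modnn.
  - by lia.
have Gv : vset G v.
  by have [_ [vz _]] := z_adj (ord_pred (Ordinal (ltn_trans (ltn0Sn 2) n4))); apply: adj_vset vz.
have [||i [j [ij ne]]] := ball_cycle_chord Gv n4 (z := z).
- by split=> //; split=> // i; have [] := z_adj i.
- move=> i; have [ij [iv jv]] := z_adj i.
  have edge x : adj G v x -> walk G 1 (fun k => if k is 0 then x else v).
    move=> vx; split=> [[|k] _|[|k] //= _]; [exact: adj_vsetr vx|by []|exact: adj_sym].
  apply: (ball_adj_of_walks ij (edge _ iv) _ _ (edge _ jv)) => //; lia.
- exists i, j; split=> //; split=> //.
  have nbr k : adj G v (z k) by have [_ []] := z_adj k.
  by split; apply: nbr.
Qed.

End FromBalls.

(** * The host graph of cliques *)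
Lemma count_ltn (T : eqType) (P Q : pred T) s w :
  w \in s -> P w -> ~~ Q w -> (forall u, Q u -> P u) -> count Q s < count P s.
Proof.
move=> ws Pw Qw QP; elim: s ws => //= u s IH; rewrite inE => /orP[/eqP <-|/IH lt].
  by rewrite Pw (negbTE Qw) add0n add1n ltnS; apply: sub_count.
by have := QP u; case: (Q u) (P u) => [] [] //= H; do ?lia; have := H isT.
Qed.

Lemma graph_ext T (G K : graph T) : vset G = vset K ->
  (forall x y, adj G x y <-> adj K x y) -> G = K.
Proof.
case: G K => [V a s i v] [V' a' s' i' v'] /= E; rewrite -{}E in v' *.
move=> aE; have E : a = a' by apply/funext => x; apply/funext => y; apply/propext.
by rewrite -{}E in s' i' v' *; congr Graph; apply: Prop_irrelevance.
Qed.

Section CliqueHost.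
Variables (T : Type) (G : graph T).
Implicit Types (S X Y : set T) (v w : T).

Definition link X : graph T := induced G [set w | forall x, X x -> adj G w x].

(** One vertex in each component of the link, presented as a function that is
    constant on components. *)
Definition link_rep X w : T := xget (w : {classic T}) [set w' | reachable (link X) w w'].

Lemma link_rep_reachable X w : vset (link X) w -> reachable (link X) w (link_rep X w).
Proof.
move=> Lw; have : [set w' | reachable (link X) w w'] (link_rep X w); last by [].
by apply: xgetPex; exists w; apply: reachable_refl.
Qed.

(** The default value of [xget] is never used, so the chosen vertex depends only
    on the component as a set. *)
Lemma link_rep_eq X v w : reachable (link X) v w -> link_rep X v = link_rep X w.
Proof.
move=> vw; rewrite /link_rep.
have -> : [set u | reachable (link X) v u] = [set u | reachable (link X) w u].
  apply/seteqP; split=> u /=; apply: reachable_trans => //; exact: reachable_sym.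
rewrite /xget; case: pselect => // no; case: no.
by exists w; apply/asboolP; apply: reachable_refl; have [_] := reachable_vset vw.
Qed.

(** [S'] is obtained from [S] by adding the chosen vertex of some component of
    the link of [S]; so [S] is covered once per component. *)
Definition covers S S' : Prop := [/\ clique G S, S !=set0 &
  exists w, [/\ vset (link S) w, link_rep S w = w & S' = S `|` [set w]]].

Lemma link_notin X w : vset (link X) w -> ~ X w.
Proof. by move=> [_ Lw] Xw; apply: (@adj_irr _ G w); apply: Lw. Qed.

Lemma clique_add X w : clique G X -> vset (link X) w -> clique G (X `|` [set w]).
Proof.
move=> [XV XE] [Gw Lw]; split=> [x [/XV //|->//]|x y [Xx|->] [Xy|->] ne].
- exact: XE.
- by apply: adj_sym; apply: Lw.
- exact: Lw.
- by [].
Qed.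

#[local] Obligation Tactic := idtac.

Program Definition clique_host : graph (set T) :=
  @Graph (set T) [set S | clique G S /\ S !=set0]
    (fun S S' => covers S S' \/ covers S' S) _ _ _.
Next Obligation. by move=> S S' [|] ?; [right|left]. Qed.
Next Obligation.
by move=> S [] [_ _ [w [/link_notin nw _ E]]]; apply: nw; rewrite E; right.
Qed.
Next Obligation.
move=> S S' [] [Sc S0 [w [Lw _ E]]]; first by split.
by rewrite E; split; [apply: clique_add | exists w; right].
Qed.

(** The intersection of the co-parts of the vertices in [X]: bags are the cliques
    themselves. *)
Definition star X : graph (set T) := induced clique_host [set S | X `<=` S].

Lemma star_vset X S : vset (star X) S <-> [/\ clique G S, S !=set0 & X `<=` S].
Proof. by split=> [[[]]|[]]. Qed.

Lemma star_sub X Y : X `<=` Y -> subgraph (star Y) (star X).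
Proof.
move=> XY; split=> [S [HS YS]|S S' [SS' [YS YS']]]; first by split=> //; apply: subset_trans YS.
by split=> //; split; apply: subset_trans XY _.
Qed.

Lemma star_capE X Y : gcap (star X) (star Y) = star (X `|` Y).
Proof.
apply: graph_ext => [|S S'].
  apply/seteqP; split=> S; first by move=> [[HS XS] [_ YS]]; split=> //; rewrite /= subUset; split.
  by move=> [HS] /=; rewrite subUset => -[XS YS].
split=> [[[SS' [XS XS']] [_ [YS YS']]]|[SS' []] /=].
  by split=> //=; rewrite !subUset; do !split.
by rewrite !subUset => -[XS YS] [XS' YS'].
Qed.

Lemma star_self X : clique G X -> X !=set0 -> vset (star X) X.
Proof. by move=> Xc X0; apply/star_vset; split. Qed.

Lemma star_diff X S : vset (star X) S -> S <> X -> exists w, S w /\ ~ X w.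
Proof.
move=> /star_vset[_ _ XS] ne; apply: contrapT => no; apply: ne.
apply/seteqP; split=> // w Sw; apply: contrapT => nw; apply: no; by exists w.
Qed.

Lemma star_link X S w : vset (star X) S -> S w -> ~ X w -> vset (link X) w.
Proof.
move=> /star_vset[[SV SE] _ XS] Sw nXw; split=> [|x Xx]; first exact: SV.
by apply: SE => //; [apply: XS | move=> E; apply: nXw; rewrite E].
Qed.

Lemma star_add X S w : vset (star X) S -> S w -> vset (star (X `|` [set w])) S.
Proof.
move=> /star_vset[Sc S0 XS] Sw; apply/star_vset; split=> //.
by rewrite subUset; split=> // _ ->.
Qed.

Lemma star_rep_edge X w : clique G X -> X !=set0 -> vset (link X) w ->
  link_rep X w = w -> adj (star X) X (X `|` [set w]).
Proof.
move=> Xc X0 Lw rw; split; last by split=> // x; left.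
by left; split=> //; exists w.
Qed.

Lemma link_add X v w : adj (link X) v w -> vset (link (X `|` [set v])) w.
Proof.
move=> [vw [Lv Lw]]; split; first exact: adj_vsetr vw.
by move=> x [/Lw //|->]; apply: adj_sym.
Qed.

Lemma clique_nonempty_add X w : clique G X -> X !=set0 -> vset (link X) w ->
  clique G (X `|` [set w]) /\ X `|` [set w] !=set0.
Proof. by move=> Xc X0 Lw; split; [apply: clique_add | exists w; right]. Qed.

Hypothesis lf : locally_finite G.

(** Induction from larger to smaller cliques. All cliques containing a vertex [v]
    consist of [v] and some of its finitely many neighbours. *)
Lemma clique_ind (P : set T -> Prop) :
  (forall X, clique G X -> X !=set0 ->
     (forall w, vset (link X) w -> P (X `|` [set w])) -> P X) ->
  forall X, clique G X -> X !=set0 -> P X.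
Proof.
move=> step X Xc [v Xv].
have /(@finite_seqP {classic T})[s sE] := lf (Xc.1 v Xv).
have in_s w : adj G v w -> (w : {classic T}) \in s.
  by move=> vw; have : [set w | adj G v w] w by []; rewrite sE.
pose left X := count (fun w : {classic T} => ~~ `[< X w >]) s.
elim: {X}(left X).+1 {-2}X (ltnSn (left X)) Xc Xv => // n IH X leX Xc Xv.
apply: step => //; first by exists v.
move=> w Lw; apply: IH; [|exact: clique_add|by left].
have lt : left (X `|` [set w]) < left X; last by lia.
apply: (@count_ltn _ _ _ _ (w : {classic T})).
- by apply: in_s; apply: adj_sym; apply: Lw.2.
- by apply/asboolP; apply: link_notin.
- by apply/negPn/asboolP; right.
- by move=> u; apply: contraNN => /asboolP Xu; apply/asboolP; left.
Qed.

(** A clique [S] above [X] contains some [w] outside [X] and is linked to [X + w]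
    by induction. Moving [w] along the edges of the link of [X] does not leave
    the component of [X + w] in the star, as [X + v + w] lies above both [X + v]
    and [X + w]. This reaches the chosen vertex of the component of [w], and so
    the edge from there to [X]. *)
Lemma star_connected X : clique G X -> X !=set0 -> connected (star X).
Proof.
move: X; apply: (@clique_ind (fun X => connected (star X))) => X Xc X0 IH.
apply/connectedP => f fX.
have f_add w S : vset (link X) w -> vset (star X) S -> S w -> f S = f (X `|` [set w]).
  move=> Lw XS Sw; have /connectedP conn := IH w Lw.
  have [Ac A0] := clique_nonempty_add Xc X0 Lw.
  apply: conn; [|exact: star_add|exact: star_self].
  by apply: locally_constant_sub fX; apply: star_sub => x; left.
have f_link : locally_constant (link X) (fun w => f (X `|` [set w])).
  move=> v w vw; have [Lv Lw] := (adj_vset vw, adj_vsetr vw).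
  have [Ac A0] := clique_nonempty_add Xc X0 Lv.
  have [Bc B0] := clique_nonempty_add Ac A0 (link_add vw).
  have XB : vset (star X) (X `|` [set v] `|` [set w]).
    by apply/star_vset; split=> // x Xx; left; left.
  by rewrite -(f_add v _ Lv XB) -?(f_add w _ Lw XB) //; [right|left; right].
suff K S : vset (star X) S -> f S = f X by move=> S S' /K -> /K ->.
move=> XS; have [->//|/(star_diff XS)[w [Sw nXw]]] := pselect (S = X).
have Lw := star_link XS Sw nXw; rewrite (f_add w) //.
have wr := link_rep_reachable Lw; rewrite (locally_constant_reachable f_link wr).
apply/esym/fX/star_rep_edge => //; first by have [_] := reachable_vset wr.
by rewrite -(link_rep_eq wr).
Qed.

Hypothesis link_chordal : forall X, X !=set0 -> chordal (link X).

(** The stars of [X + v] and [X + w] meet exactly when [v] and [w] are adjacent,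
    and then in the star of [X + v + w]; so the nerve is the link of [X]. *)
Lemma star_above_acyclic X : clique G X -> X !=set0 ->
  (forall w, vset (link X) w -> acyclic (star (X `|` [set w]))) ->
  acyclic (gbigcup (vset (link X)) (fun w => star (X `|` [set w]))).
Proof.
move=> Xc X0 IH; apply: acyclic_nerve => // [|v w Lv Lw vw [S [Sv Sw]]|v w vw|u v w uv vw wu].
- exact: link_chordal.
- have [[[_ Sc] _] /= vS] := Sv; have [_ /= wS] := Sw.
  by split; [apply: Sc => //; [apply: vS|apply: wS]; right | split; [apply: Lv.2|apply: Lw.2]].
- have [Lv Lw] := (adj_vset vw, adj_vsetr vw).
  have [Ac A0] := clique_nonempty_add Xc X0 Lv.
  have [Bc B0] := clique_nonempty_add Ac A0 (link_add vw).
  rewrite /overlap star_capE.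
  have -> : X `|` [set v] `|` (X `|` [set w]) = X `|` [set v] `|` [set w].
    by rewrite setUACA setUid setUA.
  by split; [apply: star_connected | exists (X `|` [set v] `|` [set w]); apply: star_self].
- have [Lu Lv] := (adj_vset uv, adj_vsetr uv).
  have [Ac A0] := clique_nonempty_add Xc X0 Lu.
  have [Bc B0] := clique_nonempty_add Ac A0 (link_add uv).
  have Lw : vset (link (X `|` [set u] `|` [set v])) w.
    have [Gw Xw] := adj_vset wu.
    split=> // x [[Xx|->]|->]; [exact: Xw|exact: wu.1|].
    by apply: adj_sym; apply: vw.1.
  have [Cc C0] := clique_nonempty_add Bc B0 Lw.
  exists (X `|` [set u] `|` [set v] `|` [set w]).
  by split; apply/star_vset; split=> // x [Xx|->]; do ?[by right|left].
Qed.

(** All edges above [X] but not at [X] itself lie in the union of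
    [star_above_acyclic]. The vertex [X] sends one edge to each component of its
    link, so a potential of the union can be shifted on each component to match
    the value 0 at [X]. *)
Lemma star_acyclic X : clique G X -> X !=set0 -> acyclic (star X).
Proof.
move: X; apply: (@clique_ind (fun X => acyclic (star X))) => X Xc X0 IH.
apply/acyclicP => c c_sym.
have /acyclicP/(_ c c_sym)[F Fc] := star_above_acyclic Xc X0 IH.
pose att w := X `|` [set link_rep X w].
pose shift w := F (att w) (+) c X (att w).
have shift_eq S v w : vset (star X) S -> S v -> ~ X v -> S w -> ~ X w -> shift v = shift w.
  move=> XS Sv nv Sw nw; suff : link_rep X v = link_rep X w by rewrite /shift /att => ->.
  have [Lv Lw] := (star_link XS Sv nv, star_link XS Sw nw).
  have [->//|ne] := pselect (v = w); apply: link_rep_eq.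
  apply: reachable_step (reachable_refl Lv) _.
  by have [[[_ Sc] _] _] := XS; split; [apply: Sc | split; [apply: Lv.2|apply: Lw.2]].
(* At X itself no w qualifies, so that f X is false. *)
pose f S := `[< exists w, [/\ S w, ~ X w & F S (+) shift w] >].
have fX : f X = false by apply/asboolP => -[w []].
have fE S w : vset (star X) S -> S w -> ~ X w -> f S = F S (+) shift w.
  move=> XS Sw nw; rewrite /f; case: asboolP => [[v [Sv nv <-]]|no].
    by rewrite (shift_eq S v w).
  by case E: (_ (+) _) => //; case: no; exists w.
have f_covers S S' : vset (star X) S -> vset (star X) S' -> covers S S' ->
    f S (+) f S' = c S S'.
  move=> XS XS' SS'; have [Sc S0 [u [Lu ru E]]] := SS'.
  have S'u : S' u by rewrite E; right.
  have [EX|/(star_diff XS)[w [Sw nw]]] := pselect (S = X).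
    rewrite EX fX; rewrite EX in Lu ru E.
    rewrite (fE S' u) //; last exact: link_notin.
    by rewrite /shift /att ru -E addKb.
  have S'w : S' w by rewrite E; left.
  rewrite (fE S w) ?(fE S' w) // -(Fc S S').
    by case: (F S) (F S') (shift w) => [] [] [].
  exists w; first exact: star_link Sw nw.
  split; first by left.
  by split; [apply: (star_add XS Sw).2 | apply: (star_add XS' S'w).2].
exists f => S S' SS'; have [XS XS'] := (adj_vset SS', adj_vsetr SS').
case: SS' => -[cov|cov] _; first exact: f_covers.
by rewrite addbC c_sym; apply: f_covers.
Qed.

Definition clique_part v : graph (set T) := full_part clique_host id v.

Lemma clique_partE v : clique_part v = star [set v].
Proof.
apply: graph_ext => [|S S'].
  apply/seteqP; split=> S; first by move=> [HS [_ Sv]]; split=> // _ ->.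
  by move=> [HS vS]; do 2?split=> //; apply: vS.
split; first by move=> [SS' [[_ Sv] [_ S'v]]]; split=> //; split=> _ ->.
move=> [SS' [vS vS']]; have [HS HS'] := (adj_vset SS', adj_vsetr SS').
by split=> //; split; split=> //; [apply: vS | apply: vS'].
Qed.

Lemma clique1 v : vset G v -> clique G [set v].
Proof. by move=> Gv; split=> [_ ->//|x y -> ->]. Qed.

Lemma clique2 v w : adj G v w -> clique G [set v; w].
Proof.
move=> vw; apply: clique_add; first by apply: clique1; apply: adj_vset vw.
by split=> [|_ ->]; [exact: adj_vsetr vw | exact: adj_sym].
Qed.

Lemma clique_host_decomposition : graph_decomposition G clique_host id clique_part.
Proof.
have conn v : vset G v -> connected (clique_part v).
  by move=> Gv; rewrite clique_partE; apply: star_connected; [apply: clique1|exists v].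
split; first by move=> S [[SV _] _].
split; last by split=> // v Gv; split; [apply: conn | split=> //; apply: subgraph_refl].
split; split.
- by move=> v Gv; exists [set v]; [split; [apply: clique1 | exists v] | split].
- move=> v w vw; exists [set v; w]; last by split=> //; split; [left|right].
  by split; [apply: clique2 | exists v; left].
- by move=> v [S _ [Gv _]].
- by move=> v w [S _ [vw _]].
Qed.

(** The nerve of the co-parts of the vertices in [Y] is the graph induced on
    [Y], whose cycles have length at most [r] and therefore have chords. *)
Lemma clique_host_acyclic r :
  (forall n (z : 'I_n -> T), 3 < n <= r -> is_cycle G z -> has_chord G z) ->
  r_acyclic G clique_part r.
Proof.
move=> holes Y YG Yr.
have -> : gbigcup Y clique_part = gbigcup (vset (induced G Y)) clique_part.
  by rewrite /= setIidr.
apply: acyclic_nerve => [n z n4 [n3 [z_inj z_adj]]|v [Gv _]|v w [Gv Yv] [Gw Yw] ne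
  |v w vw|u v w uv vw wu].
- have zY i : Y (z i) by have [_ []] := z_adj i.
  have nr : n <= r.
    rewrite -card_le_II; apply: card_le_trans Yr.
    have zI : ([set z i | i in setT] #= [set: 'I_n])%card.
      by apply: inj_card_eq => i j _ _; apply: z_inj.
    rewrite (card_le_eql card_II) -(card_le_eql zI).
    by apply: subset_card_le => _ [i _ <-].
  have [||i [j [ij ne]]] := holes n z; first by rewrite n4 nr.
    by split=> //; split=> // i; have [] := z_adj i.
  by exists i, j.
- by rewrite clique_partE; apply: star_acyclic; [apply: clique1|exists v].
- rewrite /overlap !clique_partE => -[S [/star_vset[Sc _ Sv] /star_vset[_ _ Sw]]].
  by split=> //; apply: Sc.2 => //; [apply: Sv|apply: Sw].
- have vwc := clique2 vw.1; have vw0 : [set v; w] !=set0 by exists v; left.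
  rewrite /overlap !clique_partE star_capE.
  by split; [apply: star_connected | exists [set v; w]; apply: star_self].
- exists ([set u; v] `|` [set w]); rewrite !clique_partE.
  have uvwc : clique G ([set u; v] `|` [set w]).
    apply: clique_add; first exact: clique2 uv.1.
    split; first exact: adj_vset wu.1.
    by move=> x [->|->]; [apply: wu.1 | apply: adj_sym; apply: vw.1].
  have n0 : [set u; v] `|` [set w] !=set0 by exists w; right.
  by split; apply/star_vset; split=> // _ ->; by [left; left|left; right|right].
Qed.

End CliqueHost.

Lemma chordal_induced_sub T (G : graph T) (X Y : set T) :
  X `<=` Y -> chordal (induced G Y) -> chordal (induced G X).
Proof.
move=> XY Ych n z n4 [n3 [z_inj z_adj]].
have [|i [j [[ij _] ne]]] := Ych n z n4.
  by split=> //; split=> // i; have [ij [xi xj]] := z_adj i; split=> //; split; apply: XY.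
exists i, j; split=> //; split=> //.
have zX k : X (z k) by have [_ []] := z_adj k.
by split.
Qed.

Theorem hole_wheel_free_decomposition T (G : graph T) r :
  locally_finite G -> hole_wheel_free G r ->
  [/\ graph_decomposition G (clique_host G) id (full_part (clique_host G) id),
      into_cliques G (clique_host G) id &
      r_acyclic G (full_part (clique_host G) id) r].
Proof.
move=> lf [holes wheels]; split.
- exact: clique_host_decomposition.
- by move=> S [].
- apply: clique_host_acyclic => // X [v Xv]; apply: chordal_induced_sub (wheels v).
  by move=> w Lw; apply: adj_sym; apply: Lw.
Qed.

(** * Acyclic decompositions induce local separations *)
Section BoundaryPairs.
Variable T : Type.
Implicit Types (G : graph T) (X : set T).

(** An unordered pair with exactly one end in [X] can be read as an ordered
    pair. *)
Lemma pair_eq X v w v' w' : [set v; w] = [set v'; w'] -> X v -> X v' -> ~ X w -> ~ X w' ->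
  v = v' /\ w = w'.
Proof.
move=> E Xv Xv' nw nw'.
have [Ev|Ev] : [set v'; w'] v by rewrite -E; left.
  split=> //; have [Ew|//] : [set v'; w'] w by rewrite -E; right.
  by case: nw; rewrite Ew.
by case: nw'; rewrite -Ev.
Qed.

Lemma boundary_pair G X v w : edge_boundary G X [set v; w] -> X v -> adj G v w /\ ~ X w.
Proof.
move=> [x [y [xy [Xx [ny E]]]]] Xv.
have [Ey|Ey] : [set v; w] y by rewrite E; right.
  by case: ny; rewrite Ey.
rewrite -Ey; split=> //; have [Ex|Ex] : [set v; w] x by rewrite E; left.
  by rewrite -Ex.
by case: ny; rewrite Ey -Ex.
Qed.

Lemma del_edge_swap G a b : subgraph (del_edge G a b) (del_edge G b a).
Proof. by split=> // x y [xy ne]; split=> //; rewrite (setUC [set b]). Qed.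

End BoundaryPairs.

Section InducedSeparations.
Variables (T U : Type) (G : graph T) (H : graph U) (bag : U -> set T) (r : nat).
Let part := full_part H bag.
Hypothesis dec : graph_decomposition G H bag part.
Hypothesis rac : r_acyclic G part r.
Hypothesis r1 : 1 < r.

Lemma full_part_vset v h : vset (part v) h <-> vset H h /\ bag h v.
Proof. by split=> [[_ []]|[Hh hv]]. Qed.

Lemma full_part_edge v a b : adj H a b -> bag a v -> bag b v -> adj (part v) a b.
Proof.
by move=> ab av bv; do !split=> //; [exact: adj_vset ab|exact: adj_vsetr ab].
Qed.

Lemma del_edge_part a b Y v : Y v ->
  subgraph (del_edge (part v) a b) (del_edge (gbigcup Y part) a b).
Proof. by move=> Yv; split=> [h vh|x y [xy ne]]; [exists v | split=> //; exists v]. Qed.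

(** A co-part that contains the edge [ab] belongs to a vertex in the bags of both
    [a] and [b]. *)
Lemma del_edge_avoiding a b Y Z : Z `<=` Y -> (forall v, Z v -> ~ (bag a `&` bag b) v) ->
  subgraph (gbigcup Z part) (del_edge (gbigcup Y part) a b).
Proof.
move=> ZY avoid; split=> [h [v Zv vh]|x y [v Zv vxy]]; first by exists v => //; apply: ZY.
split; first by exists v => //; apply: ZY.
move=> E; apply: (avoid v Zv); have [_ [[_ vx] [_ vy]]] := vxy.
split; [have : [set x; y] a by rewrite E; left|have : [set x; y] b by rewrite E; right];
  by move=> [->|->].
Qed.

Lemma adj_parts_cap_connected v w : adj G v w -> connected (gcap (part v) (part w)).
Proof.
move=> vw; have Gv := adj_vset vw; have Gw := adj_vsetr vw.
apply: (@connected_gcap _ (gbigcup [set v; w] part)).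
- apply: (small_parts_acyclic rac (n := 2) (w := fun i => if i is 0 then v else w)) => //.
    by move=> [|i] _.
  by move=> x [->|->]; [exists 0 | exists 1].
- by split=> [k|k l] ?; exists v => //; left.
- by split=> [k|k l] ?; exists w => //; right.
- exact: (part_connected dec Gv).
- exact: (part_connected dec Gw).
Qed.

Section Edge.
Variables a b : U.
Hypothesis ab : adj H a b.
Let X := bag a `&` bag b.

Let XG : X `<=` vset G.
Proof. by move=> v [av _]; have [bagG _] := dec; apply: bagG av; apply: adj_vset ab. Qed.

Lemma full_part_bridge v : X v -> ~ reachable (del_edge (part v) a b) a b.
Proof.
move=> Xv; have [av bv] := Xv; apply: acyclic_bridge; last exact: full_part_edge.
exact: (vertex_acyclic rac (ltnW r1) (XG Xv)).
Qed.

(** If the edge [vw] lay on both sides, the connected intersection of the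
    co-parts of [v] and [w] would join the two sides of the co-part of [v]; it
    does not use the edge [ab], since [w] is not in both bags. *)
Lemma sides_disjoint : side_edges G H bag a b `&` side_edges G H bag b a = set0.
Proof.
apply/seteqP; split=> // e [[v [w [Xv [E [eb [h [hh hr] hw]]]]]]].
move=> [v' [w' [Xv' [E' [_ [h' [hh' hr'] hw']]]]]].
rewrite -/X in Xv eb; rewrite setIC -/X in Xv'.
have [vw nw] := boundary_pair (eq_ind _ (edge_boundary G X) eb _ E) Xv.
have [vw' nw'] := boundary_pair (eq_ind _ (edge_boundary G X) eb _ E') Xv'.
have [Ev Ew] := pair_eq (etrans (esym E) E') Xv Xv' nw nw'.
rewrite -{}Ev -{}Ew {v' w' E' Xv' vw' nw'} in hh' hr' hw' *.
have cap := adj_parts_cap_connected vw.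
have hv : vset (part v) h := hh; have hv' : vset (part v) h' := hh'.
have Hh := (full_part_vset _ _).1 hv; have Hh' := (full_part_vset _ _).1 hv'.
have hh'_cap : reachable (gcap (part v) (part w)) h h'.
  by apply: cap; split=> //; apply/full_part_vset; split=> //; [exact: Hh.1|exact: Hh'.1].
apply: (full_part_bridge Xv); apply: reachable_trans hr _.
apply: reachable_trans (reachable_sub (del_edge_swap _ _ _) (reachable_sym hr')).
apply: reachable_sub hh'_cap; split=> [k [//]|x y [vxy wxy]]; split=> // E2.
have [_ [[_ wx] [_ wy]]] := wxy; apply: nw.
split; [have : [set x; y] a by rewrite E2; left|have : [set x; y] b by rewrite E2; right];
  by move=> [->|->].
Qed.

(** The co-part of [v] is connected, so after the deletion of [ab] each of its
    nodes can still be reached from [a] or from [b]. *)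
Lemma sides_cover :
  side_edges G H bag a b `|` side_edges G H bag b a = edge_boundary G X.
Proof.
apply/seteqP; split=> e.
  by move=> [|] [v [w [_ [_ [eb _]]]]] //; rewrite /X setIC.
move=> eb; have [v [w [vw [Xv [nw E]]]]] := eb.
have Gv := adj_vset vw; have [h [Hh hv hw]] := adj_common_node dec vw.
have [av bv] := Xv; have [Ha Hb] := (adj_vset ab, adj_vsetr ab).
pose reach c := reachable (del_edge (part v) a b) c.
have /connectedP conn := part_connected dec Gv.
have refl c : vset H c -> bag c v -> reach c c.
  by move=> Hc cv; apply: reachable_refl; apply/full_part_vset.
have : `[< reach a a \/ reach b a >] = `[< reach a h \/ reach b h >].
  apply: (conn (fun k => `[< reach a k \/ reach b k >]));
    [|exact/full_part_vset|exact/full_part_vset].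
  move=> x y xy; have [E2|ne] := pselect ([set x; y] = [set a; b]).
    have in_ab k : [set a; b] k -> reach a k \/ reach b k.
      by move=> [->|->]; [left|right]; apply: refl.
    by rewrite !asboolT //; apply: in_ab; rewrite -E2; [right|left].
  have xyD : adj (del_edge (part v) a b) x y by split.
  apply: asbool_equiv_eq; split=> -[] k; [left|right|left|right];
    by [apply: reachable_step k xyD|apply: reachable_step k (adj_sym xyD)].
rewrite asboolT; last by left; apply: refl.
move=> /esym/asboolP[ah|bh]; [left|right]; exists v, w; split=> //.
  by split=> //; split=> //; exists h => //; split=> //; apply/full_part_vset.
split=> //; split; first by rewrite setIC.
exists h => //; split; first exact/full_part_vset.
by apply: reachable_sub bh; apply: del_edge_swap.
Qed.

(** A boundary edge on an outer walk is its first or its last edge; its end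
    outside [X] is an inner vertex [w j]. The bag shared by the two ends of the
    edge sits at a node [h] that the deletion of [ab] leaves on the side of [c].
    Here [c] is [a] or [b]; treating both cases at once needs the hypothesis on
    unordered pairs. *)
Lemma side_edge_of_outer_walk c d n w i :
  [set c; d] = [set a; b] -> outer_walk G X n w -> i < n ->
  side_edges G H bag c d [set w i; w i.+1] ->
  exists x j h, [/\ [set w i | i in `I_n.+1] x, 0 < j < n,
    reachable (del_edge (part x) a b) c h & vset (part (w j)) h].
Proof.
move=> E [[wV wE] [w0 [wn inner]]] lt.
have XE : bag c `&` bag d = X.
  have Xcd : (bag c `&` bag d) = [set v | forall k, [set c; d] k -> bag k v].
    apply/seteqP; split=> v; first by move=> [cv dv] k [->|->].
    by move=> cd; split; apply: cd; [left|right].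
  rewrite Xcd E /X; apply/seteqP; split=> v; last by move=> [av bv] k [->|->].
  by move=> all; split; apply: all; [left|right].
have DE v : subgraph (del_edge (part v) c d) (del_edge (part v) a b).
  by split=> // x y [xy ne]; split=> //; rewrite -E.
move=> [x [y [Xx [Exy [eb [h [hx hr] hy]]]]]].
rewrite XE in Xx eb; rewrite Exy in eb; have [xy ny] := boundary_pair eb Xx.
have [j jn Ey] : exists2 j, j <= n & y = w j.
  have : [set w i; w i.+1] y by rewrite Exy; right.
  by move=> [->|->]; [exists i; rewrite // ltnW | exists i.+1].
have j0 : 0 < j by rewrite lt0n; apply/eqP => j0; apply: ny; rewrite Ey j0.
have jn' : j < n by rewrite ltn_neqAle jn andbT; apply/eqP => jn'; apply: ny; rewrite Ey jn'.
exists x, j, h; split.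
- have : [set w i; w i.+1] x by rewrite Exy; left.
  by move=> [->|->]; [exists i; rewrite //= ltnS ltnW | exists i.+1].
- by rewrite j0 jn'.
- exact: reachable_sub (DE x) hr.
- by rewrite -Ey; apply/full_part_vset; split=> //; exact: ((full_part_vset x h).1 hx).1.
Qed.

(** Suppose that a walk inside a cycle of length at most [r] traverses both
    sides. The co-parts of all its vertices form an acyclic graph in which [ab]
    is a bridge. But [a] and [b] remain joined without [ab]: within the co-parts
    of the two ends of the walk, and between these through the co-parts of the
    inner vertices, which avoid [ab]. *)
Lemma edge_local_separation :
  local_separation G r (side_edges G H bag a b) X (side_edges G H bag b a).
Proof.
split; first by split=> //; split; [apply: sides_disjoint | apply: sides_cover].
move=> n w [wX wC] [[i0 i0n e0] [i1 i1n e1]].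
have [x0 [j0 [h0 [Yx0 /andP[j00 j0n] r0 j0h]]]] := side_edge_of_outer_walk (erefl _) wX i0n e0.
have [x1 [j1 [h1 [Yx1 /andP[j10 j1n] r1' j1h]]]] := side_edge_of_outer_walk (setUC _ _) wX i1n e1.
set Y := [set w i | i in _] in Yx0 Yx1.
have [[wV wE] [w0 [wn inner]]] := wX.
have Yac : acyclic (gbigcup Y part).
  case: wC => [[m [c [c_cyc [mr [wc _]]]]]|[n1 _]]; last by exfalso; lia.
  apply: rac => [_ [i /= lt <-]|]; first exact: wV.
  have /card_le_trans : (Y #<= [set c i | i in setT])%card.
    by apply: subset_card_le => _ [i /= lt <-]; have [k ->] := wc i lt; exists k.
  apply; apply: card_le_trans (card_image_le _ _) _.
  by rewrite -(card_le_eql card_II) card_le_II.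
have [aX bX] := w0.
apply: (acyclic_bridge Yac) (_ : adj _ a b) _.
  by exists (w 0); [exists 0 | apply: full_part_edge].
have sub x : Y x -> subgraph (del_edge (part x) a b) (del_edge (gbigcup Y part) a b).
  exact: del_edge_part.
apply: reachable_trans (reachable_sub (sub _ Yx0) r0) _.
apply: reachable_trans (reachable_sub (sub _ Yx1) (reachable_sym r1')).
pose Z := [set w i.+1 | i in `I_(n - 2).+1].
have Zc : connected (gbigcup Z part).
  apply: (walk_parts_connected dec (n := n - 2) (w := fun i => w i.+1)).
  by split=> i lt; [apply: wV | apply: wE]; lia.
have ZY : subgraph (gbigcup Z part) (del_edge (gbigcup Y part) a b).
  apply: del_edge_avoiding => [_ [i /= lt <-]|_ [i /= lt <-]]; last by apply: inner; lia.
  by exists i.+1 => //=; lia.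
have inZ j : 0 < j < n -> Z (w j).
  by case: j => // j /andP[_ lt]; exists j => //=; lia.
by apply: reachable_sub ZY _; apply: Zc; [exists (w j0)|exists (w j1)] => //; apply: inZ; apply/andP.
Qed.

End Edge.

Lemma acyclic_induces_local_separations : induces_local_separations G H bag r.
Proof.
split=> [v Gv|]; last by split=> [u v uv|a b ab];
  [apply: adj_parts_cap_connected | apply: edge_local_separation].
split; first exact: (part_nonempty dec Gv).
by split; [apply: (part_connected dec Gv) | apply: (vertex_acyclic rac (ltnW r1) Gv)].
Qed.

End InducedSeparations.

(** * Local separations exclude short holes and wheels *)
Section SeparationsToHoles.
Variables (T U : Type) (G : graph T) (H : graph U) (bag : U -> set T) (r : nat).
Let part := full_part H bag.
Hypothesis dec : graph_decomposition G H bag part.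
Hypothesis cliques : into_cliques G H bag.
Hypothesis seps : induces_local_separations G H bag r.

(** On a walk in the co-part of [v] from a node shared with [u] to a node shared
    with [w], take the edge where the co-part of [u] is left for the last time.
    After it, the walk avoids the node [a] and hence the edge [ab]. *)
Lemma separating_edge v u w : vset G v -> overlap (part v) (part u) ->
  overlap (part v) (part w) ->
  (forall h, vset H h -> bag h v -> bag h u -> ~ bag h w) ->
  exists a b h, [/\ adj (part v) a b, bag a u, ~ bag b u, bag h w &
    vset (component (del_edge (part v) b a) b) h].
Proof.
move=> Gv [hu [vhu uhu]] [hw [vhw whw]] none; apply: contrapT => no_edge.
pose away := induced (part v) [set h | ~ bag h u].
have [Hhu huv] := (full_part_vset _ _ _ _).1 vhu.
have [Hhw hwv] := (full_part_vset _ _ _ _).1 vhw.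
have [[_ huu] [_ hww]] := ((full_part_vset _ _ _ _).1 uhu, (full_part_vset _ _ _ _).1 whw).
have nwu : ~ bag hw u by move=> hwu; apply: (none hw).
have /connectedP conn := part_connected dec Gv.
have : `[< reachable away hw hw >] = `[< reachable away hw hu >]; last first.
  rewrite asboolT; last exact: reachable_refl.
  by move=> /esym/asboolP wu; have [_ [_ nu]] := reachable_vset wu; apply: nu.
apply: (conn (fun k => `[< reachable away hw k >])) => // .
have crossing a b : adj (part v) a b -> reachable away hw b -> reachable away hw a.
  move=> ab wb; have [_ [_ nbu]] := reachable_vset wb.
  have [au|nau] := pselect (bag a u); last first.
    by apply: reachable_step wb _; split; [exact: adj_sym | split].
  case: no_edge; exists a, b, hw; split=> //; split=> //.
  apply: reachable_sym; apply: reachable_sub wb.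
  split=> [h []//|x y [xy [nx ny]]]; split=> // E.
  have [Ea|Ea] : [set x; y] a by rewrite E; right.
    by apply: nx; rewrite -Ea.
  by apply: ny; rewrite -Ea.
move=> a b ab; apply: asbool_equiv_eq; split; apply: crossing => //.
exact: adj_sym.
Qed.

(** The crossing argument. Otherwise some edge [ab] of the co-part of [z 0]
    separates the co-part of [z 1] from that of [z n]. No vertex of the cycle
    other than [z 0] lies in the bags of both [a] and [b]: it would be adjacent
    to [z 0], hence [z 1] or [z n]. So the cycle, started at [z 0], is a local
    walk which leaves [z 0] on one side and returns on the other. *)
Lemma short_cycle_common_node n (z : 'I_n.+1 -> T) : n < r -> is_cycle G z ->
  (forall k : 'I_n.+1, adj G (z (inord 0)) (z k) -> k = inord 1 \/ k = inord n) ->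
  exists h, [/\ vset H h, bag h (z (inord 0)), bag h (z (inord 1)) & bag h (z (inord n))].
Proof.
move=> nr z_cyc nbrs; apply: contrapT => none; have [n3 [z_inj z_adj]] := z_cyc.
pose zz i := z (inord (i %% n.+1)).
have zzE i : i <= n -> zz i = z (inord i) by move=> le; rewrite /zz modn_small.
have zz_end : zz n.+1 = zz 0 by rewrite /zz modnn mod0n.
have zzA i : adj G (zz i) (zz i.+1) by rewrite /zz -ordS_inord_mod.
have zzV i : vset G (zz i) by apply: adj_vset (zzA i).
rewrite -!zzE // in none; last by lia.
have nz : adj G (zz 0) (zz n) by apply: adj_sym; rewrite -zz_end; apply: zzA.
have [a [b [h [ab au nbu hw hb]]]] :
    exists a b h, [/\ adj (part (zz 0)) a b, bag a (zz 1), ~ bag b (zz 1), bag h (zz n) &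
      vset (component (del_edge (part (zz 0)) b a) b) h].
  apply: separating_edge => //; try exact: (part_overlap dec).
  by move=> k Hk k0 k1 kn; apply: none; exists k.
have [abH [[Ha av] [Hb bv]]] := ab.
pose X := bag a `&` bag b.
have inner i : 0 < i < n.+1 -> ~ X (zz i).
  move=> /andP[i0 lt] [ai bi].
  have : adj G (zz 0) (zz i).
    apply: (cliques Ha).2 => //; rewrite !zzE // => /z_inj/(congr1 val).
    by rewrite /= !inordK //; lia.
  rewrite !zzE // => /nbrs[] /(congr1 val); rewrite /= !inordK //; try lia.
    by move=> E; apply: nbu; rewrite -E.
  by move=> E; apply: none; exists a; split=> //; rewrite -E.
have [_ [_ /(_ _ _ abH)[_ no_cross]]] := seps.
apply: (no_cross n.+1 zz).
  split; first split; first by split.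
    by split; [|split; [rewrite zz_end|exact: inner]].
  left; exists n.+1, z; split=> //; split=> //.
  by split=> i _; eexists; [|rewrite /zz -ordS_inord_mod].
have Ha' : vset (del_edge (part (zz 0)) a b) a by exact: adj_vset ab.
split.
  exists 0 => //; exists (zz 0), (zz 1); split=> //; split=> //; split.
    exists (zz 0), (zz 1); split=> //; split=> //; split=> //.
    by apply: inner; lia.
  by exists a => //; split=> //; apply: reachable_refl.
exists n => //; exists (zz 0), (zz n); split=> //; split; first by rewrite zz_end setUC.
split; last by exists h.
exists (zz 0), (zz n); split=> //; split=> //; split; last by rewrite zz_end setUC.
by rewrite setIC; apply: inner; lia.
Qed.

Hypothesis r2 : 2 < r.

(** The Helly property of the co-parts, which holds because triangles are short
    cycles. *)
Lemma triangle_common_node x y w : adj G x y -> adj G y w -> adj G w x ->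
  exists h, [/\ vset H h, bag h x, bag h y & bag h w].
Proof.
move=> xy yw wx.
have z_cyc := triangle_cycle xy yw wx.
have [|h [Hh hx hy hw]] := @short_cycle_common_node 2 (triangle x y w) r2 z_cyc.
  move=> [[|[|[|k]]] lt] // zk; [|left|right]; try by apply: val_inj; rewrite /= inordK.
  by exfalso; move: zk; rewrite /triangle inordK //=; apply: adj_irr.
by move: hx hy hw; rewrite /triangle !inordK //=; exists h.
Qed.

(** On an induced cycle of length at most [r], [short_cycle_common_node] gives a
    bag containing two non-adjacent vertices. For a cycle in the neighbourhood
    of [v], of any length, the co-parts of its vertices trace subtrees in the
    co-part of [v], and consecutive ones meet by [triangle_common_node]. *)
Lemma hole_wheel_free_of_separations : hole_wheel_free G r.
Proof.
split=> [[//|n] z /andP[n4 nr] z_cyc|v n z n4 [n3 [z_inj z_adj]]].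
  have [n3 [z_inj z_adj]] := z_cyc.
  have ordSE k : k <= n -> ordS (inord k : 'I_n.+1) = inord (k.+1 %% n.+1).
    by move=> le; rewrite -ordS_inord_mod modn_small.
  apply: contrapT => no_chord.
  have chord k l : adj G (z (inord k)) (z (inord l)) -> k <= n -> l <= n ->
      l <> k.+1 %% n.+1 -> k <> l.+1 %% n.+1 -> False.
    move=> kl kn ln lk lk'; apply: no_chord; exists (inord k), (inord l).
    rewrite !ordSE //; split=> //.
    by split; apply/eqP; apply: inord_neq => //; rewrite -ltnS ltn_pmod.
  have [k k0|h [Hh h0 h1 hn]] := short_cycle_common_node nr z_cyc.
    apply: contrapT => /not_orP[k1 kn].
    have kE : k = inord k by rewrite inord_val.
    rewrite {1}kE in k0; apply: (chord _ _ k0) => //; first by rewrite -ltnS.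
      by rewrite modn_small //; [move=> E; apply: k1; rewrite kE E | lia].
    move=> E; apply: kn; rewrite kE; congr inord.
    have := ltn_ord k; rewrite ltnS leq_eqVlt => /orP[/eqP //|lt].
    by rewrite modn_small in E.
  apply: (chord 1 n); try lia; last by rewrite modnn; lia.
    by apply: (cliques Hh).2 => // /z_inj; apply: inord_neq; lia.
  by rewrite modn_small; lia.
have nbr i : adj G v (z i) by have [_ []] := z_adj i.
have zA i : adj G (z i) (z (ordS i)) by have [] := z_adj i.
have Gv : vset G v by have := nbr (ord_pred (Ordinal (ltn_trans (ltn0Sn 2) n4))); apply: adj_vset.
have [trees [caps _]] := seps; have [_ [_ v_acyclic]] := trees v Gv.
have [i|i|i [j [ij ji1 ij1 [h [[zih vh] [zjh _]]]]]] :=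
    @subtrees_cycle_chord _ _ _ (fun i => gcap (part (z i)) (part v)) n4 v_acyclic.
- split; first by split=> [h|h h'] [].
  by apply: caps; apply: adj_sym.
- have [h [Hh hv hz hz']] := triangle_common_node (nbr i) (zA i) (adj_sym (nbr (ordS i))).
  by exists h; split; split; apply/full_part_vset.
- exists i, j; split; last by split; apply/eqP.
  have [[Hh hi] [_ hj]] := ((full_part_vset _ _ _ _).1 zih, (full_part_vset _ _ _ _).1 zjh).
  by split; [apply: (cliques Hh).2 => // /z_inj | split; apply: nbr].
Qed.

End SeparationsToHoles.

(** * The equivalences *)
Lemma locally_chordal_iff_hole_wheel_free T (G : graph T) r :
  locally_finite G -> 2 < r -> locally_chordal G r <-> hole_wheel_free G r.
Proof.
move=> lf r2; split; first exact: hole_wheel_free_of_balls.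
move=> /(hole_wheel_free_decomposition lf)[dec cl rac].
by apply: (locally_chordal_of_decomposition r2 dec cl); apply: (locally_induces dec rac); lia.
Qed.

Lemma decomposition_of_region_representation T U (G : graph T) (H : graph U) part :
  region_representation G H part ->
  graph_decomposition G H (fun h => [set v | vset G v /\ vset (part v) h]) part /\
  into_cliques G H (fun h => [set v | vset G v /\ vset (part v) h]).
Proof.
move=> [reg rep]; set bag := fun h => _.
have full v : vset G v -> spanning_subgraph (part v) (full_part H bag v).
  move=> Gv; have [[pV pE] _] := reg v Gv.
  split; first split=> [h vh|x y xy]; first by do !split=> //; apply: pV.
    have vx := adj_vset xy; have vy := adj_vsetr xy.
    by split; [apply: pE | do !split=> //; apply: pV].
  apply/seteqP; split=> h; last by move=> [_ [_ [_ vh]]].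
  by move=> vh; do !split=> //; apply: pV.
split; last first.
  move=> h Hh; split=> [v [] //|v w [Gv vh] [Gw wh] ne].
  by apply/(rep v w Gv Gw ne); exists h.
split; first by move=> h _ v [].
split; [split; split|split].
- by move=> v Gv; have [[pV _] [[h vh] _]] := reg v Gv; exists h; [apply: pV | split].
- move=> v w vw; have [Gv Gw] := (adj_vset vw, adj_vsetr vw).
  have ne : v <> w by move=> E; apply: (@adj_irr _ G v); rewrite {2}E.
  have [h [vh wh]] := (rep v w Gv Gw ne).1 vw; have [[pV _] _] := reg v Gv.
  by exists h; [apply: pV | split].
- by move=> v [h _ []].
- by move=> v w [h _ []].
- move=> v Gv; have [_ [_ /connectedP conn]] := reg v Gv; have [sub E] := full v Gv.
  apply/connectedP => f fP; rewrite -E; apply: conn.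
  exact: locally_constant_sub fP.
- by move=> v Gv; split; [have [_ []] := reg v Gv | apply: full].
Qed.

Lemma region_representation_of_decomposition T U (G : graph T) (H : graph U) bag part :
  graph_decomposition G H bag part -> into_cliques G H bag -> region_representation G H part.
Proof.
move=> dec cl; split=> [v Gv|v w Gv Gw ne].
  split; last by split; [apply: (part_nonempty dec Gv) | apply: (part_connected dec Gv)].
  by split=> [h /(part_node dec _ Gv)[]//|x y /(part_adj dec Gv)[]].
split; first exact: (part_overlap dec).
move=> [h [vh wh]]; have [Hh hv] := (part_node dec h Gv).1 vh.
by apply: (cl h Hh).2 => //; have [] := (part_node dec h Gw).1 wh.
Qed.

Theorem theorem1 (T : Type) (G : graph T) (r : nat)
    (hG : locally_finite G) (hr : 3 <= r) :
  [<-> locally_chordal G r;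
       acyclic_region_intersection_graph G r;
       exists (U : Type) (H : graph U) (bag : U -> set T) (part : T -> graph U),
         graph_decomposition G H bag part /\ into_cliques G H bag /\
         r_acyclic G part r;
       exists (U : Type) (H : graph U) (bag : U -> set T) (part : T -> graph U),
         graph_decomposition G H bag part /\ into_cliques G H bag /\
         locally_induces_tree_decompositions G bag part r;
       exists (U : Type) (H : graph U) (bag : U -> set T),
         graph_decomposition G H bag (full_part H bag) /\ into_cliques G H bag /\
         induces_local_separations G H bag r].
Proof.
have r1 : 1 < r by apply: ltnW.
tfae.
- move=> /(locally_chordal_iff_hole_wheel_free hG hr)/(hole_wheel_free_decomposition hG)[dec cl rac].
  exists (set T), (clique_host G), (full_part (clique_host G) id); split=> //.
  exact: region_representation_of_decomposition dec cl.
- move=> [U [H [part [rep rac]]]].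
  have [dec cl] := decomposition_of_region_representation rep.
  by exists U, H, (fun h => [set v | vset G v /\ vset (part v) h]), part.
- move=> [U [H [bag [part [dec [cl rac]]]]]].
  by exists U, H, bag, part; split=> //; split=> //; apply: (locally_induces dec rac r1).
- move=> [U [H [bag [part [dec [cl loc]]]]]].
  have /(locally_chordal_iff_hole_wheel_free hG hr) := locally_chordal_of_decomposition hr dec cl loc.
  move=> /(hole_wheel_free_decomposition hG)[dec' cl' rac'].
  exists (set T), (clique_host G), id; split=> //; split=> //.
  exact: acyclic_induces_local_separations.
- move=> [U [H [bag [dec [cl seps]]]]].
  apply/(locally_chordal_iff_hole_wheel_free hG hr).
  exact: (hole_wheel_free_of_separations dec cl seps hr).
Qed.
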